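(* Let $\delta\in(0,1)$, $\Delta\ge3$ and $0<\beta<(1-\delta)\beta_u(2,\Delta)$, where $\beta_u(2,\Delta)=\ln\frac{\Delta}{\Delta-2}$. Suppose $G=(V,E)$ is an $n$-vertex graph of maximum degree $\Delta$. For any ordering $\phi$ of the vertices of $G$, the mixing time of the symmetrized systematic scan dynamics $P_\phi$ for the ferromagnetic Ising model on $G$ with parameter $\beta$ satisfies $T_{mix}(P_\phi)=O(\log n)$, where the implied constant depends only on $\delta$ (even when $\Delta$ depends on $n$).
   Context: Ising model: $\mu(\sigma)=e^{-H(\sigma)}/Z$ for $\sigma\in\{-1,+1\}^V$ with $H(\sigma)=-\beta\sum_{\{u,v\}\in E}\mathbf 1(\sigma_u=\sigma_v)$. Systematic scan: for an ordering $\phi=[v_1,\dots,v_n]$ of $V$, let $P_i$ be the transition matrix of the heat-bath update at $v_i$ (the spin at $v_i$ is resampled from the conditional distribution of $\mu$ at $v_i$ given the configuration on $V\setminus\{v_i\}$). Then $P_\phi=P_1P_2\cdots P_n\,P_nP_{n-1}\cdots P_1$. Mixing time: for an ergodic chain $P$ on $\Omega$ with stationary distribution $\mu$, $T_{mix}(P)=\min\{t>0:\max_{x\in\Omega}\|P^t(x,\cdot)-\mu\|_{TV}\le1/4\}$. *)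

(* Defs.v *)
From HB Require Import structures.
From mathcomp Require Import all_boot all_order all_algebra.
From mathcomp Require Import all_classical all_reals all_analysis.

Set Implicit Arguments.
Unset Strict Implicit.
Unset Printing Implicit Defensive.

Import Order.TTheory GRing.Theory Num.Theory.

Local Open Scope ring_scope.

Definition simple_graph (V : finType) (e : rel V) : Prop :=
  symmetric e /\ irreflexive e.

Definition degree (V : finType) (e : rel V) (v : V) : nat :=
  #|[set u | e v u]|.

Definition max_degree (V : finType) (e : rel V) : nat :=
  \max_(v : V) degree e v.

(* Unordered edges, so that each {u, v} is counted once in the Hamiltonian. *)
Definition edges (V : finType) (e : rel V) : {set {set V}} :=
  [set [set p.1; p.2] | p : V * V & e p.1 p.2].

(* Spin configurations; [true] stands for +1 and [false] for -1. *)
Definition config (V : finType) : finType := {ffun V -> bool}.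

Definition monochromatic (V : finType) (s : config V) (f : {set V}) : bool :=
  [forall u in f, forall v in f, s u == s v].

Definition hamiltonian (R : realType) (V : finType) (e : rel V) (beta : R)
    (s : config V) : R :=
  - beta * \sum_(f in edges e) (monochromatic s f)%:R.

Definition partition_function (R : realType) (V : finType) (e : rel V)
    (beta : R) : R :=
  \sum_(s : config V) expR (- hamiltonian e beta s).

Definition ising (R : realType) (V : finType) (e : rel V) (beta : R)
    (s : config V) : R :=
  expR (- hamiltonian e beta s) / partition_function e beta.

Definition agree_off (V : finType) (v : V) (s t : config V) : bool :=
  [forall u, (u != v) ==> (s u == t u)].

(* A chain on Omega is a matrix whose rows and columns are indexed by Omega
   through [enum_val] and [enum_rank]. *)
Definition heat_bath (R : realType) (V : finType) (mu : config V -> R)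
    (v : V) : 'M[R]_#|config V| :=
  \matrix_(i, j)
    let s := enum_val i in let t := enum_val j in
    if agree_off v s t then mu t / \sum_(r | agree_off v s r) mu r else 0.

Definition vertex_ordering (V : finType) (phi : seq V) : Prop :=
  perm_eq phi (enum V).

Definition symmetrized_scan (R : realType) (V : finType)
    (mu : config V -> R) (phi : seq V) : 'M[R]_#|config V| :=
  (\prod_(v <- phi) heat_bath mu v) * (\prod_(v <- rev phi) heat_bath mu v).

Definition tv_dist (R : realType) (Omega : finType) (p q : Omega -> R) : R :=
  2^-1 * \sum_x `|p x - q x|.

(* The maximum over starting states of ||P^t(x,.) - mu||_TV; the default 0 of
   the iterated maximum is harmless since [tv_dist] is nonnegative. *)
Definition max_tv (R : realType) (Omega : finType) (P : 'M[R]_#|Omega|)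
    (mu : Omega -> R) (t : nat) : R :=
  \big[Num.max/0]_(x : Omega)
    tv_dist (fun y => (P ^+ t) (enum_rank x) (enum_rank y)) mu.

(* T = min {t > 0 : max_tv P mu t <= 1/4}, as a predicate since this set is
   empty for some non-ergodic P. *)
Definition is_mixing_time (R : realType) (Omega : finType)
    (P : 'M[R]_#|Omega|) (mu : Omega -> R) (T : nat) : Prop :=
  [/\ (0 < T)%N, max_tv P mu T <= 4^-1 &
      forall t : nat, (0 < t)%N -> max_tv P mu t <= 4^-1 -> (T <= t)%N].

(* Uniqueness threshold of the Ising model (the q = 2 Potts model) on the
   Delta-regular tree. *)
Definition beta_u2 (R : realType) (Delta : nat) : R :=
  ln (Delta%:R / (Delta%:R - 2)).

(* Main.v *)
Require Import Defs.
From HB Require Import structures.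
From mathcomp Require Import all_boot all_order all_algebra.
From mathcomp Require Import all_classical all_reals all_analysis.
From mathcomp Require Import ring lra zify.

(** Let [theta = tanh (beta / 2)], the largest change of the heat-bath probability
    at a site when one neighbour is flipped. Below the uniqueness threshold
    [theta * (Delta - 1) < 1]. The Dobrushin condition [theta * Delta < 1] would
    make a single update contract; between the two conditions one compares with
    updates of whole balls, following Mossel and Sly; the monotonicity of the
    ferromagnetic model makes the comparison possible. No couplings are used:
    everything is expressed by the update operators acting on functions of the
    configuration.

    Reduction to a gap. Heat-bath updates preserve increasing functions. A
    function [f] bounded by one becomes increasing when it is added to, or
    subtracted from, twice the number of plus spins, so the dependence of the
    expectation of [f] on the starting point is controlled by the sum over [v]
    of the differences of the probabilities of a plus at [v] when starting from
    all plus and from all minus ([total_gap], [sweep_oscillation]). The total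
    variation distance to equilibrium is at most that gap ([max_tv_scan_le]).

    Censoring. Updates are self-adjoint for the Gibbs weight, and two increasing
    functions are positively correlated on each pair of configurations differing
    at one site. Hence leaving out updates can only increase the gap at [v]
    ([censor_top], [censor_bot]). For each [v] one is therefore free to keep only
    the updates inside a set [B] around [v]; if the result depends on the spin at
    [u] by at most [K v u] and the column sums of [K] are at most [kappa < 1],
    the total gap contracts by [kappa] ([total_gap_contract]).

    Choice of [B]. When [Delta] is at least [4 / delta], the choice [B = {v}] works
    with the margin [1 - delta / 2] ([total_gap_dobrushin]). For each of the
    finitely many smaller degrees, [B] is a ball of fixed radius around [v]. A
    bounded number of scans brings [B] close to its conditional equilibrium, as
    each scan makes all spins of [B] plus with probability bounded below
    ([sweep_repeat_cexp]). The equilibrium influence of a boundary spin [u] on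
    [v] is at most the sum of [theta ^+ length] over self-avoiding walks from [u]
    to [v] ([flip_influence]), and walks that leave a large ball have small total
    weight, since each step has at most [Delta - 1] continuations ([saw_tail],
    [block_influence_col]).

    In both cases a constant number of scans multiplies the gap by a constant
    below one, and the gap starts at [n], so logarithmically many scans suffice
    ([log_steps]). *)

Set Implicit Arguments.
Unset Strict Implicit.
Unset Printing Implicit Defensive.

Import Order.TTheory GRing.Theory Num.Theory.

Local Open Scope ring_scope.

(** * Configurations and their fibres *)

Section Configurations.
Context {V : finType}.
Implicit Types (v w : V) (a : bool) (s t : config V) (B : {set V}).

Definition upd v a s : config V := [ffun u => if u == v then a else s u].

Definition agree_outside B s t : bool := [forall u, (u \notin B) ==> (s u == t u)].

Lemma upd_same v a s : upd v a s v = a.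
Proof. by rewrite ffunE eqxx. Qed.

Lemma upd_other v a s u : u != v -> upd v a s u = s u.
Proof. by move=> /negPf uv; rewrite ffunE uv. Qed.

Lemma upd_id v s : upd v (s v) s = s.
Proof. by apply/ffunP => u; rewrite ffunE; case: eqP => [->|]. Qed.

Lemma upd_upd v a a' s : upd v a (upd v a' s) = upd v a s.
Proof. by apply/ffunP => u; rewrite !ffunE; case: eqP. Qed.

Lemma upd_comm v w a a' s : v != w ->
  upd v a (upd w a' s) = upd w a' (upd v a s).
Proof.
move=> /negPf vw; apply/ffunP => u; rewrite !ffunE.
by case: (eqVneq u v) => [->|//]; rewrite vw.
Qed.

Lemma agree_outsideP B s t :
  reflect (forall u, u \notin B -> s u = t u) (agree_outside B s t).
Proof.
apply: (iffP forallP) => [h u uB | h u]; last by apply/implyP => /h ->.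
by apply/eqP; exact: (implyP (h u)).
Qed.

Lemma agree_outside_refl B s : agree_outside B s s.
Proof. exact/agree_outsideP. Qed.

Lemma agree_outside_sym B s t : agree_outside B s t = agree_outside B t s.
Proof.
by apply/agree_outsideP/agree_outsideP => h u /h ->.
Qed.

Lemma agree_outside_trans B s t r :
  agree_outside B s t -> agree_outside B t r -> agree_outside B s r.
Proof.
move=> /agree_outsideP st /agree_outsideP tr; apply/agree_outsideP => u uB.
by rewrite st // tr.
Qed.

Lemma agree_outside_upd B v a s : v \in B -> agree_outside B s (upd v a s).
Proof.
move=> vB; apply/agree_outsideP => u uB; rewrite upd_other //.
by apply: contraNneq uB => ->.
Qed.

Lemma agree_outside_updr B v a s t : v \in B ->
  agree_outside B s (upd v a t) = agree_outside B s t.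
Proof.
move=> vB; have h := agree_outside_upd a t vB.
apply/idP/idP => [st|st]; last exact: agree_outside_trans st h.
by apply: agree_outside_trans st _; rewrite agree_outside_sym.
Qed.

Lemma agree_outside_setD1 B v a s t : v \in B ->
  agree_outside (B :\ v) (upd v a s) t = agree_outside B s t && (t v == a).
Proof.
move=> vB; apply/agree_outsideP/andP => [h|[/agree_outsideP h /eqP tv] u].
  split; last by rewrite -h ?upd_same // !inE eqxx.
  apply/agree_outsideP => u uB; rewrite -h ?inE ?negb_and ?uB ?orbT //.
  by rewrite upd_other //; apply: contraNneq uB => ->.
rewrite !inE negb_and negbK; case: (eqVneq u v) => [->|uv /=].
  by rewrite upd_same tv.
by move=> /h <-; rewrite upd_other.
Qed.

Lemma agree_outside_setU1 B v a s t : v \notin B ->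
  agree_outside B (upd v a s) t = agree_outside (v |: B) s t && (t v == a).
Proof.
by move=> vB; rewrite -agree_outside_setD1 ?setU11 ?setU1K.
Qed.

Lemma agree_outside0 s t : agree_outside finset.set0 s t = (t == s).
Proof.
apply/agree_outsideP/eqP => [h|-> //].
by apply/ffunP => u; rewrite h // inE.
Qed.

Lemma agree_offE v s t : agree_off v s t = agree_outside [set v] s t.
Proof. by apply: eq_forallb => u; rewrite !inE. Qed.

Lemma sum_pairs (R : realType) v (F : config V -> R) :
  \sum_s F s = \sum_(s : config V | s v) (F (upd v true s) + F (upd v false s)).
Proof.
rewrite (bigID (fun s : config V => s v)) /= big_split /=; congr (_ + _).
  by apply: eq_bigr => s sv; rewrite -sv upd_id.
rewrite (reindex_onto (upd v false) (upd v true)) /=; last first.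
  by move=> s /negPf sv; rewrite upd_upd -sv upd_id.
apply: eq_bigl => s; rewrite upd_same /= upd_upd.
apply/eqP/idP => [<-|sv]; first by rewrite upd_same.
by rewrite -sv upd_id.
Qed.

End Configurations.

(** * Gibbs conditional expectations *)

Section Gibbs.
Context {R : realType} {V : finType} {e : rel V}.
Hypothesis e_sym : symmetric e.
Hypothesis e_irr : irreflexive e.
Variable beta : R.
Hypothesis beta_ge0 : 0 <= beta.
Implicit Types (u v w : V) (a : bool) (s t : config V) (B : {set V}) (l : seq V).
Implicit Types (b c : V -> R) (f : config V -> R).

Definition spin (a : bool) : R := if a then 1 else -1.

(** This is [- hamiltonian] up to an additive constant. The factor [4] comes from
    each edge entering twice and from the product of two spins taking the values
    [1] and [-1], at distance [2]. *)
Definition energy s : R :=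
  beta / 4 * \sum_x \sum_y (e x y)%:R * spin (s x) * spin (s y).

(** The external field [b] serves to express the flip of a frozen spin; the Ising
    measure itself has no field. *)
Definition weight b s : R := expR (energy s + \sum_x b x * spin (s x)).

Lemma weight_gt0 b s : 0 < weight b s.
Proof. exact: expR_gt0. Qed.

Lemma weight_field b c s :
  weight (fun x => b x + c x) s = weight b s * expR (\sum_x c x * spin (s x)).
Proof.
rewrite /weight -expRD -addrA -big_split /=; congr (expR (_ + _)).
by apply: eq_bigr => x _; rewrite mulrDl.
Qed.

Definition local_field v s : R := \sum_x (e v x)%:R * spin (s x).

Lemma local_field_upd v a s : local_field v (upd v a s) = local_field v s.
Proof.
apply: eq_bigr => x _; case: (eqVneq x v) => [->|xv]; last by rewrite upd_other.
by rewrite e_irr !mul0r.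
Qed.

Lemma energy_upd v s :
  energy (upd v true s) = energy (upd v false s) + beta * local_field v s.
Proof.
pose rest := \sum_(x | x != v) \sum_(y | y != v)
  (e x y)%:R * spin (s x) * spin (s y).
have E a : energy (upd v a s) =
    beta / 4 * (2 * (spin a * local_field v s) + rest).
  rewrite /energy (bigD1 v) //=; congr (_ * _); rewrite mulr2n mulrDl mul1r.
  rewrite -addrA; congr (_ + _).
    rewrite -(local_field_upd v a) mulr_sumr; apply: eq_bigr => y _.
    by rewrite upd_same; ring.
  rewrite -(local_field_upd v a) [local_field _ _](bigD1 v) //= e_irr mul0r add0r.
  rewrite mulr_sumr -big_split /=; apply: eq_bigr => x xv.
  rewrite (bigD1 v) //= upd_same (e_sym x v); congr (_ + _); first by ring.
  by apply: eq_bigr => y yv; rewrite !upd_other.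
by rewrite !E /spin; field.
Qed.

Lemma weight_upd b v s :
  weight b (upd v true s) =
  expR (2 * b v + beta * local_field v s) * weight b (upd v false s).
Proof.
rewrite /weight energy_upd -expRD; congr expR.
rewrite (bigD1 v) //= [in RHS](bigD1 v) //= !upd_same /spin.
rewrite (eq_bigr (fun x => b x * (if upd v false s x then 1 else -1))); first by ring.
by move=> x xv; rewrite !upd_other.
Qed.

Definition up v s : R := (s v)%:R.

(** Conditional expectation given the spins outside [B], for the Gibbs measure
    with external field [b]. *)
Definition cexp B b s f : R :=
  (\sum_(t | agree_outside B s t) weight b t * f t) /
  \sum_(t | agree_outside B s t) weight b t.

Lemma fiber_weight_gt0 B b s : 0 < \sum_(t | agree_outside B s t) weight b t.
Proof.
rewrite (bigD1 s) ?agree_outside_refl //= ltr_pwDl ?weight_gt0 //.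
by apply: sumr_ge0 => t _; rewrite ltW ?weight_gt0.
Qed.

Lemma cexp_agree B b s s' f : agree_outside B s s' -> cexp B b s f = cexp B b s' f.
Proof.
move=> ss'; suff E t : agree_outside B s t = agree_outside B s' t.
  by rewrite /cexp !(eq_bigl _ _ E).
apply/idP/idP; last exact: agree_outside_trans.
by apply: agree_outside_trans; rewrite agree_outside_sym.
Qed.

Lemma eq_cexp B b s f g :
  (forall t, agree_outside B s t -> f t = g t) -> cexp B b s f = cexp B b s g.
Proof. by move=> fg; congr (_ / _); apply: eq_bigr => t /fg ->. Qed.

Lemma cexp_ge B b s f m :
  (forall t, agree_outside B s t -> m <= f t) -> m <= cexp B b s f.
Proof.
move=> fm; rewrite /cexp ler_pdivlMr ?fiber_weight_gt0 // mulr_sumr.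
apply: ler_sum => t st; rewrite mulrC ler_pM2l ?weight_gt0 //; exact: fm.
Qed.

Lemma cexp_le B b s f m :
  (forall t, agree_outside B s t -> f t <= m) -> cexp B b s f <= m.
Proof.
move=> fm; rewrite /cexp ler_pdivrMr ?fiber_weight_gt0 // mulr_sumr.
apply: ler_sum => t st; rewrite [leRHS]mulrC ler_pM2l ?weight_gt0 //; exact: fm.
Qed.

Lemma cexp0 b s f : cexp finset.set0 b s f = f s.
Proof.
have E t : agree_outside finset.set0 s t = pred1 s t by rewrite agree_outside0.
rewrite /cexp !(eq_bigl _ _ E).
by rewrite !big_pred1_eq mulrC mulKf // gt_eqF ?weight_gt0.
Qed.

Lemma fiber_split B v s (F : config V -> R) : v \in B ->
  \sum_(t | agree_outside B s t) F t =
  \sum_(t | agree_outside (B :\ v) (upd v true s) t) F t +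
  \sum_(t | agree_outside (B :\ v) (upd v false s) t) F t.
Proof.
move=> vB; rewrite (bigID (fun t : config V => t v)) /=; congr (_ + _);
  by apply: eq_bigl => t; rewrite agree_outside_setD1 //; case: (t v).
Qed.

Lemma fiber_up B v b s : v \in B ->
  \sum_(t | agree_outside B s t) weight b t * up v t =
  \sum_(t | agree_outside (B :\ v) (upd v true s) t) weight b t.
Proof.
move=> vB; rewrite (fiber_split _ _ vB) [X in _ + X]big1 ?addr0.
  apply: eq_bigr => t; rewrite agree_outside_setD1 // => /andP[_ /eqP tv].
  by rewrite /up tv mulr1.
move=> t; rewrite agree_outside_setD1 // => /andP[_ /eqP tv].
by rewrite /up tv mulr0.
Qed.

Lemma cexp_up B v b s : v \in B ->
  cexp B b s (up v) =
  (\sum_(t | agree_outside (B :\ v) (upd v true s) t) weight b t) /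
  (\sum_(t | agree_outside (B :\ v) (upd v true s) t) weight b t +
   \sum_(t | agree_outside (B :\ v) (upd v false s) t) weight b t).
Proof. by move=> vB; rewrite /cexp (fiber_up _ _ vB) (fiber_split _ _ vB). Qed.

(** Law of total expectation, revealing the spin at [v]. *)
Lemma cexp_reveal B v b s f : v \in B ->
  cexp B b s f =
  cexp B b s (up v) * cexp (B :\ v) b (upd v true s) f +
  (1 - cexp B b s (up v)) * cexp (B :\ v) b (upd v false s) f.
Proof.
move=> vB; rewrite (cexp_up _ _ vB) /cexp 2!(fiber_split _ _ vB).
have := fiber_weight_gt0 (B :\ v) b (upd v true s).
have := fiber_weight_gt0 (B :\ v) b (upd v false s).
set p := \sum_(t | _) weight b t; set q := \sum_(t | _) weight b t => p0 q0.
by field; rewrite !gt_eqF ?addr_gt0.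
Qed.

(** A field acting on a site whose spin is fixed has no effect. *)
Lemma cexp_field_outside B b c s f : (forall x, x \in B -> c x = 0) ->
  cexp B (fun x => b x + c x) s f = cexp B b s f.
Proof.
move=> cB; pose k := expR (\sum_x c x * spin (s x)).
have E t : agree_outside B s t -> weight (fun x => b x + c x) t = k * weight b t.
  move=> /agree_outsideP st; rewrite weight_field mulrC; congr (expR _ * _).
  apply: eq_bigr => x _; case: (boolP (x \in B)) => [/cB -> | /st -> //].
  by rewrite !mul0r.
rewrite /cexp (eq_bigr _ E) (eq_bigr (fun t => k * (weight b t * f t))).
  by rewrite -!mulr_sumr -mulf_div divff ?mul1r // gt_eqF ?expR_gt0.
by move=> t /E ->; rewrite mulrA.
Qed.

(** Reversing a frozen spin amounts to adding a field on its neighbours. *)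
Lemma cexp_flip B w b s f : w \notin B ->
  (forall t, f (upd w true t) = f (upd w false t)) ->
  cexp B b (upd w true s) f =
  cexp B (fun x => b x + beta * (e w x)%:R) (upd w false s) f.
Proof.
move=> wB fw; pose k := expR (2 * b w).
have E t : weight b (upd w true t) =
    k * weight (fun x => b x + beta * (e w x)%:R) (upd w false t).
  rewrite weight_upd weight_field expRD -mulrA; congr (_ * _); rewrite mulrC.
  congr (_ * expR _); rewrite -(local_field_upd w false) mulr_sumr.
  by apply: eq_bigr => x _; rewrite mulrA.
have shift (F : config V -> R) : \sum_(t | agree_outside B (upd w true s) t) F t =
    \sum_(t | agree_outside B (upd w false s) t) F (upd w true t).
  rewrite (reindex_onto (upd w true) (upd w false)) /=; last first.
    by move=> t; rewrite agree_outside_setU1 // => /andP[_ /eqP <-];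
      rewrite upd_upd upd_id.
  apply: eq_bigl => t; rewrite !agree_outside_setU1 // upd_same upd_upd andbT.
  rewrite agree_outside_updr ?setU11 //; congr (_ && _).
  by apply/eqP/eqP => [<-|<-]; rewrite ?upd_same ?upd_id.
have fixw t : agree_outside B (upd w false s) t -> t = upd w false t.
  by rewrite agree_outside_setU1 // => /andP[_ /eqP <-]; rewrite upd_id.
rewrite /cexp !shift.
under eq_bigr => t /fixw tw do rewrite E fw -tw -mulrA.
under [in X in _ / X]eq_bigr => t /fixw tw do rewrite E -tw.
by rewrite -!mulr_sumr -mulf_div divff ?mul1r // gt_eqF ?expR_gt0.
Qed.

(** * Influence of a frozen spin through self-avoiding walks *)

Lemma fiber_field B w k b s a : w \in B ->
  \sum_(t | agree_outside (B :\ w) (upd w a s) t)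
    weight (fun x => b x + (x == w)%:R * k) t =
  expR (k * spin a) * \sum_(t | agree_outside (B :\ w) (upd w a s) t) weight b t.
Proof.
move=> wB; rewrite mulr_sumr; apply: eq_bigr => t.
rewrite agree_outside_setD1 // => /andP[_ /eqP tw].
rewrite weight_field mulrC (bigD1 w) //= eqxx mul1r tw big1 ?addr0 //.
by move=> x /negPf ->; rewrite !mul0r.
Qed.

Definition theta : R := (expR beta - 1) / (expR beta + 1).

Lemma expR_beta_ge1 : 1 <= expR beta.
Proof. by rewrite -expR0 ler_expR. Qed.

Lemma theta_ge0 : 0 <= theta.
Proof. by rewrite divr_ge0 ?subr_ge0 ?addr_ge0 ?expR_ge0 ?expR_beta_ge1. Qed.

Lemma odds_shift_bounds (y p q : R) : 1 <= y -> 0 < p -> 0 < q ->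
  0 <= y * p / (y * p + y^-1 * q) - p / (p + q) <= (y - 1) / (y + 1).
Proof.
move=> y1 p0 q0; have y0 : 0 < y by exact: lt_le_trans y1.
have yp : 0 < y ^+ 2 * p + q by rewrite addr_gt0 // mulr_gt0 ?exprn_gt0.
have pq : 0 < p + q by rewrite addr_gt0.
have -> : y * p / (y * p + y^-1 * q) = y ^+ 2 * p / (y ^+ 2 * p + q).
  have -> : y ^+ 2 * p + q = y * (y * p + y^-1 * q).
    by rewrite mulrDr mulVKf ?gt_eqF // mulrA expr2.
  by rewrite expr2 -[y * y * p]mulrA -mulf_div divff ?mul1r ?gt_eqF.
have D0 : 0 < (y ^+ 2 * p + q) * (p + q) by rewrite mulr_gt0.
have -> : y ^+ 2 * p / (y ^+ 2 * p + q) - p / (p + q) =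
    (y ^+ 2 - 1) * (p * q) / ((y ^+ 2 * p + q) * (p + q)).
  by rewrite -mulNr addf_div ?gt_eqF //; congr (_ / _); ring.
apply/andP; split.
  apply: divr_ge0; last exact: ltW.
  by rewrite mulr_ge0 // ?subr_ge0 ?exprn_ege1 // ltW // mulr_gt0.
rewrite ler_pdivrMr // mulrAC ler_pdivlMr; last by rewrite addr_gt0.
have -> : (y ^+ 2 - 1) * (p * q) * (y + 1) = (y - 1) * ((y + 1) ^+ 2 * (p * q)).
  by ring.
rewrite ler_wpM2l ?subr_ge0 // -subr_ge0.
have -> : (y ^+ 2 * p + q) * (p + q) - (y + 1) ^+ 2 * (p * q) = (y * p - q) ^+ 2.
  by ring.
exact: sqr_ge0.
Qed.

(** Adding the field [beta] at [w] multiplies the odds of [w] by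
    [expR (2 * beta)]; a probability moves the most when the old and new odds
    are inverse to each other, and then it moves by exactly [theta]. *)
Lemma up_field_bounds B w b s : w \in B ->
  0 <= cexp B (fun x => b x + (x == w)%:R * beta) s (up w)
       - cexp B b s (up w) <= theta.
Proof.
move=> wB; rewrite 2!(cexp_up _ _ wB) 2!(fiber_field _ _ _ _ wB) /spin mulr1 mulrN1 expRN.
by apply: odds_shift_bounds; rewrite ?expR_beta_ge1 ?fiber_weight_gt0.
Qed.

(** Telescoping a change of field over the sites where it takes place. *)
Lemma field_telescope (F : (V -> R) -> R) (a c : V -> R) b :
  (forall b x, F (fun y => b y + (y == x)%:R * c x) - F b <= a x) ->
  F (fun y => b y + c y) - F b <= \sum_x a x.
Proof.
move=> Fa.
have E : (fun y => b y + c y) =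
    (fun y => b y + \sum_(x <- index_enum V) (y == x)%:R * c x).
  apply/funext => y; congr (_ + _).
  rewrite (bigD1 y) //= eqxx mul1r big1 ?addr0 // => x xy.
  by rewrite eq_sym (negPf xy) mul0r.
rewrite E; elim: (index_enum V) => [|x xs IH].
  rewrite big_nil; under eq_fun do rewrite big_nil addr0.
  by rewrite subrr.
rewrite big_cons.
have -> : (fun y => b y + \sum_(z <- x :: xs) (y == z)%:R * c z) =
    (fun y => (b y + \sum_(z <- xs) (y == z)%:R * c z) + (y == x)%:R * c x).
  by apply/funext => y; rewrite big_cons [X in b y + X]addrC addrA.
by have := lerD (Fa (fun y => b y + \sum_(z <- xs) (y == z)%:R * c z) x) IH;
  rewrite addrA subrK.
Qed.

(** The weight [theta ^+ length], summed over the self-avoiding walks from [w]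
    to [v] inside [B]; [n] bounds the number of vertices of a walk. *)
Fixpoint saw (n : nat) B w v : R :=
  if n is m.+1 then
    (w == v)%:R + theta * \sum_(x in B :\ w | e w x) saw m (B :\ w) x v
  else 0.

Lemma saw_ge0 n B w v : 0 <= saw n B w v.
Proof.
elim: n B w => //= n IH B w; rewrite addr_ge0 // mulr_ge0 ?theta_ge0 //.
exact: sumr_ge0.
Qed.

Lemma saw_subset n B B' w v : B \subset B' -> saw n B w v <= saw n B' w v.
Proof.
elim: n B B' w => //= n IH B B' w BB'; rewrite lerD2l ler_wpM2l ?theta_ge0 //.
have BB'w := finset.setSD [set w] BB'.
rewrite big_mkcond [leRHS]big_mkcond; apply: ler_sum => x _.
case: ifPn => [/andP[xB ->]|_]; first by rewrite (fintype.subsetP BB'w) //= IH.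
by case: ifP => // _; exact: saw_ge0.
Qed.

(** Frozen spins influence [v] through self-avoiding walks: a flip at [w] is a
    field on the neighbours of [w], whose sites are changed one at a time; a
    field at [x] shifts the law of the spin at [x] by at most [theta], and then
    [x] acts as a frozen spin in the smaller region [B :\ x]. *)
Lemma flip_influence n B w v b s : (#|B| <= n)%N -> w \notin B -> v != w ->
  cexp B b (upd w true s) (up v) - cexp B b (upd w false s) (up v)
    <= theta * \sum_(x in B | e w x) saw n B x v.
Proof.
elim: n B w b s => [|n IH] B w b s Bn wB vw.
  move: Bn; rewrite leqn0 cards_eq0 => /eqP ->.
  rewrite !cexp0 /up !upd_other // subrr mulr_ge0 ?theta_ge0 //.
  by apply: sumr_ge0 => x _; exact: saw_ge0.
rewrite cexp_flip //; last by move=> t; rewrite /up !upd_other.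
move: (upd w false s) => {}s.
pose a x := if (x \in B) && e w x then theta * saw n.+1 B x v else 0.
rewrite mulr_sumr [leRHS]big_mkcond /= -/a.
apply: (field_telescope (F := fun b => cexp B b s (up v)) (a := a)) => {}b x.
rewrite /a.
have sawx : 0 <= theta * saw n.+1 B x v by rewrite mulr_ge0 ?theta_ge0 ?saw_ge0.
have [xB|xB] := boolP (x \in B); last first.
  rewrite /= cexp_field_outside ?subrr // => y yB.
  by case: eqP => [yx|]; rewrite ?mul0r //; rewrite -yx yB in xB.
rewrite /=; case: (e w x) => /=; last first.
  by rewrite mulr0 cexp_field_outside ?subrr // => y _; rewrite mulr0.
rewrite mulr1 2!(cexp_reveal _ _ (up v) xB).
have /andP[] := up_field_bounds b s xB.
set p' := cexp B _ s (up x); set p := cexp B _ s (up x) => pp' ppt.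
have out y : y \in B :\ x -> (y == x)%:R * beta = 0.
  by rewrite !inE => /andP[/negPf -> _]; rewrite mul0r.
rewrite !(cexp_field_outside b _ _ out).
set E1 := cexp _ _ (upd x true s) _; set E0 := cexp _ _ (upd x false s) _.
have -> : p' * E1 + (1 - p') * E0 - (p * E1 + (1 - p) * E0) = (p' - p) * (E1 - E0).
  by ring.
suff E10 : E1 - E0 <= saw n.+1 B x v.
  apply: le_trans (ler_wpM2l pp' E10) _.
  by rewrite ler_wpM2r ?saw_ge0.
rewrite /E1 /E0; have [vx|vx] := eqVneq v x.
  rewrite -vx /= eqxx.
  have eqv d : cexp (B :\ v) b (upd v d s) (up v) = d%:R.
    rewrite (@eq_cexp _ _ _ _ (fun=> d%:R)) => [|t].
      by apply/eqP; rewrite eq_le cexp_le ?cexp_ge.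
    by rewrite vx agree_outside_setD1 // /up => /andP[_ /eqP ->].
  rewrite !eqv subr0 lerDl mulr_ge0 ?theta_ge0 //.
  by apply: sumr_ge0 => y _; exact: saw_ge0.
rewrite /= eq_sym (negPf vx) add0r; apply: IH => //; last by rewrite !inE eqxx.
by move: Bn; rewrite (cardsD1 x) xB.
Qed.

(** * Heat-bath updates, monotonicity and censoring *)

Definition nofield : V -> R := fun=> 0.

Definition site_update v f s : R := cexp [set v] nofield s f.

(** The head of the word is the first update to be performed: as operators on
    functions, later updates are applied first. *)
Definition sweep l f : config V -> R := foldr site_update f l.

Lemma sweep_cat l1 l2 f : sweep (l1 ++ l2) f = sweep l1 (sweep l2 f).
Proof. by rewrite /sweep foldr_cat. Qed.

Definition plus_prob v s : R := cexp [set v] nofield s (up v).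

Lemma site_updateE v f s :
  site_update v f s =
  plus_prob v s * f (upd v true s) + (1 - plus_prob v s) * f (upd v false s).
Proof.
by rewrite /site_update (cexp_reveal _ _ _ (set11 v)) finset.setDv !cexp0.
Qed.

Lemma plus_prob_weight v s :
  plus_prob v s = weight nofield (upd v true s) /
             (weight nofield (upd v true s) + weight nofield (upd v false s)).
Proof.
have E s' t : agree_outside ([set v] :\ v) s' t = pred1 s' t.
  by rewrite finset.setDv agree_outside0.
rewrite /plus_prob (cexp_up _ _ (set11 v)).
by rewrite !(eq_bigl _ _ (E _)) !big_pred1_eq.
Qed.

Lemma plus_prob_logistic v s : plus_prob v s = (1 + expR (- (beta * local_field v s)))^-1.
Proof.
rewrite plus_prob_weight weight_upd /nofield mulr0 add0r expRN.
have := weight_gt0 nofield (upd v false s).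
have := expR_gt0 (beta * local_field v s).
move: (expR _) (weight _ _) => y z y0 z0.
by field; rewrite ?(gt_eqF z0) ?(gt_eqF y0) ?gt_eqF ?addr_gt0 ?mulr_gt0.
Qed.

Lemma plus_prob_ge0 v s : 0 <= plus_prob v s.
Proof. by rewrite plus_prob_logistic invr_ge0 addr_ge0 ?expR_ge0. Qed.

Lemma plus_prob_le1 v s : 0 <= 1 - plus_prob v s.
Proof.
by rewrite subr_ge0 plus_prob_logistic invf_le1 ?lerDl ?expR_ge0 // addr_gt0 ?expR_gt0.
Qed.

Lemma plus_prob_upd v a s : plus_prob v (upd v a s) = plus_prob v s.
Proof. by rewrite !plus_prob_logistic local_field_upd. Qed.

Definition increasing f : Prop :=
  forall v s, f (upd v false s) <= f (upd v true s).

Lemma local_field_increasing v : increasing (local_field v).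
Proof.
move=> u s; apply: ler_sum => x _; apply: ler_wpM2l => //.
by rewrite !ffunE; case: eqP => // _; rewrite /spin; lra.
Qed.

(** Ferromagnetism: the local field, hence the probability of a plus, increases
    with the neighbouring spins. *)
Lemma plus_prob_increasing v : increasing (plus_prob v).
Proof.
move=> u s; rewrite !plus_prob_logistic lef_pV2 ?posrE ?addr_gt0 ?expR_gt0 //.
by rewrite lerD2l ler_expR lerN2 ler_wpM2l // local_field_increasing.
Qed.

(** A flip of [u] to plus raises the two values that are averaged and also raises
    the weight of the larger of them. *)
Lemma site_update_increasing v f : increasing f -> increasing (site_update v f).
Proof.
move=> fi u s; rewrite !site_updateE.
have [->|uv] := eqVneq u v; first by rewrite !upd_upd !plus_prob_upd.
rewrite !(upd_comm _ _ s (_ : v != u)) 1?eq_sym //.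
have := plus_prob_increasing v u s; have := plus_prob_ge0 v (upd u false s).
have := plus_prob_le1 v (upd u true s); have := fi v (upd u false s).
have := fi u (upd v true s); have := fi u (upd v false s).
rewrite !(upd_comm _ _ s uv).
have := fi v (upd u true s).
move: (f _) (f _) (f _) (f _) (plus_prob _ _) (plus_prob _ _) => a c d g p q.
nra.
Qed.

Lemma sweep_increasing l f : increasing f -> increasing (sweep l f).
Proof. by move=> fi; elim: l => //= v l; exact: site_update_increasing. Qed.

Definition inner f g : R := \sum_s weight nofield s * f s * g s.

Lemma inner_pairs v f g :
  inner f g = \sum_(s : config V | s v)
    (weight nofield (upd v true s) * f (upd v true s) * g (upd v true s) +
     weight nofield (upd v false s) * f (upd v false s) * g (upd v false s)).
Proof. exact: sum_pairs. Qed.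

Lemma inner_site_updateE v f g :
  inner f (site_update v g) = \sum_(s : config V | s v)
    ((weight nofield (upd v true s) * f (upd v true s) +
      weight nofield (upd v false s) * f (upd v false s)) *
     (weight nofield (upd v true s) * g (upd v true s) +
      weight nofield (upd v false s) * g (upd v false s)) /
     (weight nofield (upd v true s) + weight nofield (upd v false s))).
Proof.
rewrite (inner_pairs v); apply: eq_bigr => s _.
rewrite !site_updateE !upd_upd !plus_prob_upd plus_prob_weight.
have := weight_gt0 nofield (upd v true s).
have := weight_gt0 nofield (upd v false s).
move: (weight _ _) (weight _ _) (f _) (f _) (g _) (g _) => a c p q x y a0 c0.
by field; rewrite gt_eqF ?addr_gt0.
Qed.

Lemma inner_site_update v f g :
  inner f (site_update v g) = inner (site_update v f) g.
Proof.
have innerC h k : inner h k = inner k h.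
  by apply: eq_bigr => s _; rewrite mulrAC.
rewrite [RHS]innerC !inner_site_updateE; apply: eq_bigr => s _.
by rewrite [X in X / _]mulrC.
Qed.

(** On each pair of configurations that differ at [v], two increasing functions
    are positively correlated, and averaging over the pair discards this
    correlation. *)
Lemma inner_site_update_le v f g : increasing f -> increasing g ->
  inner f (site_update v g) <= inner f g.
Proof.
move=> fi gi; rewrite inner_site_updateE (inner_pairs v).
apply: ler_sum => s _; have := fi v s; have := gi v s.
have := weight_gt0 nofield (upd v true s).
have := weight_gt0 nofield (upd v false s).
move: (weight _ _) (weight _ _) (f _) (f _) (g _) (g _).
move=> a c p q x y c0 a0 yx qp; rewrite ler_pdivrMr ?addr_gt0 // -subr_ge0.
set lhs := (X in 0 <= X).
have -> : lhs = a * c * ((p - q) * (x - y)) by rewrite /lhs; ring.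
by apply: mulr_ge0; [exact/ltW/mulr_gt0 | rewrite mulr_ge0 ?subr_ge0].
Qed.

(** Self-adjointness moves the updates that are kept to the left factor, where
    they preserve monotonicity; an update that is left out is removed by
    [inner_site_update_le]. *)
Lemma inner_censor l l' f g : subseq l' l -> increasing f -> increasing g ->
  inner f (sweep l g) <= inner f (sweep l' g).
Proof.
elim: l l' f => [|v l IH] l' f; first by rewrite subseq0 => /eqP ->.
move=> sub fi gi; have drop k : subseq k l ->
    inner f (sweep (v :: l) g) <= inner f (sweep k g).
  move=> uw; apply: le_trans (IH _ _ uw fi gi).
  by apply: inner_site_update_le => //; exact: sweep_increasing.
case: l' sub => [_|v' l' /=]; first by apply: drop; exact: sub0seq.
case: eqP => [->|_] sub; last by have := drop _ sub.
by rewrite !inner_site_update; apply: IH => //; exact: site_update_increasing.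
Qed.

Definition top : config V := [ffun=> true].
Definition bot : config V := [ffun=> false].

Lemma inner_delta s f : inner (fun t => (t == s)%:R) f = weight nofield s * f s.
Proof.
rewrite /inner (bigD1 s) //= eqxx mulr1 big1 ?addr0 // => t /negPf ->.
by rewrite mulr0 mul0r.
Qed.

(** Censoring: the point mass at [top] is an increasing function and the point
    mass at [bot] a decreasing one, so leaving out updates moves the values at
    both extremal starting points away from each other. *)
Lemma censor_top l l' f : subseq l' l -> increasing f ->
  sweep l f top <= sweep l' f top.
Proof.
move=> sub fi; rewrite -(ler_pM2l (weight_gt0 nofield top)) -!inner_delta.
apply: inner_censor => // v s; case: eqP => // st.
by have := upd_same v false s; rewrite st ffunE.
Qed.

Lemma censor_bot l l' f : subseq l' l -> increasing f ->
  sweep l' f bot <= sweep l f bot.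
Proof.
move=> sub fi; rewrite -(ler_pM2l (weight_gt0 nofield bot)) -!inner_delta.
have N h : inner (fun t => - (t == bot)%:R) h = - inner (fun t => (t == bot)%:R) h.
  by rewrite /inner -sumrN; apply: eq_bigr => t _; rewrite mulrN mulNr.
rewrite -lerN2 -!N; apply: inner_censor => // v s; rewrite lerN2.
case: eqP => // st.
by have := upd_same v true s; rewrite st ffunE.
Qed.

(** * The gap between the extremal starting points *)

Lemma sweep_linear l k f g s :
  sweep l (fun t => k * f t + g t) s = k * sweep l f s + sweep l g s.
Proof.
elim: l s => //= v l IH s; rewrite !site_updateE !IH; ring.
Qed.

Lemma sweep_const l k s : sweep l (fun=> k) s = k.
Proof. by elim: l s => //= v l IH s; rewrite site_updateE !IH; ring. Qed.

Lemma sweep_sum (I : Type) (r : seq I) (k : I -> R) (F : I -> config V -> R) l s :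
  sweep l (fun t => \sum_(i <- r) k i * F i t) s =
  \sum_(i <- r) k i * sweep l (F i) s.
Proof.
elim: r => [|i r IH].
  by under eq_fun do rewrite big_nil; rewrite sweep_const big_nil.
by under eq_fun do rewrite big_cons; rewrite sweep_linear IH big_cons.
Qed.

Lemma foldr_updE a s l u :
  foldr (fun v => upd v a) s l u = if u \in l then a else s u.
Proof.
elim: l => //= v l IH; rewrite ffunE inE IH; by case: eqP.
Qed.

Lemma increasing_le_top f s : increasing f -> f s <= f top.
Proof.
move=> fi; have -> : top = foldr (fun v => upd v true) s (enum V).
  by apply/ffunP => u; rewrite foldr_updE mem_enum ffunE.
elim: (enum V) => //= v l IH; apply: le_trans IH _.
set t := foldr _ _ _; rewrite -{1}(upd_id v t).
by case: (t v) => //; exact: fi.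
Qed.

Lemma increasing_ge_bot f s : increasing f -> f bot <= f s.
Proof.
move=> fi; have -> : bot = foldr (fun v => upd v false) s (enum V).
  by apply/ffunP => u; rewrite foldr_updE mem_enum ffunE.
elim: (enum V) => //= v l IH; apply: le_trans _ IH.
set t := foldr _ _ _; rewrite -{2}(upd_id v t).
by case: (t v) => //; exact: fi.
Qed.

Lemma up_upd v u a s : up v (upd u a s) = if v == u then a%:R else up v s.
Proof. by rewrite /up ffunE; case: eqP. Qed.

Lemma up_increasing v : increasing (up v).
Proof. by move=> u s; rewrite !up_upd; case: eqP. Qed.

Definition gap l v : R := sweep l (up v) top - sweep l (up v) bot.

Lemma gap_ge0 l v : 0 <= gap l v.
Proof.
by rewrite subr_ge0 increasing_le_top //; exact/sweep_increasing/up_increasing.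
Qed.

Definition total_gap l : R := \sum_v gap l v.

Lemma total_gap_ge0 l : 0 <= total_gap l.
Proof. by apply: sumr_ge0 => v _; exact: gap_ge0. Qed.

Lemma total_gap_nil : total_gap [::] = #|V|%:R.
Proof.
rewrite /total_gap (eq_bigr (fun=> 1)) ?sumr_const ?card_ord //.
by move=> v _; rewrite /gap /= /up !ffunE subr0.
Qed.

Definition linear_up (K : V -> R) s : R := \sum_(u <- enum V) K u * up u s.

Lemma linear_up_upd K u s :
  linear_up K (upd u true s) = linear_up K (upd u false s) + K u.
Proof.
rewrite /linear_up !(bigD1_seq u) ?mem_enum ?enum_uniq //= !up_upd eqxx.
rewrite mulr1 mulr0 add0r addrC; congr (_ + _).
by apply: eq_bigr => v /negPf vu; rewrite !up_upd vu.
Qed.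

Lemma linear_up_sub_increasing K g :
  (forall u s, g (upd u true s) - g (upd u false s) <= K u) ->
  increasing (fun s => linear_up K s + -1 * g s).
Proof.
by move=> gK u s; rewrite linear_up_upd; have := gK u s; lra.
Qed.

Lemma sweep_linear_up l K s :
  sweep l (linear_up K) s = \sum_u K u * sweep l (up u) s.
Proof. by rewrite sweep_sum big_enum. Qed.

Lemma sweep_linear_up_gap l K :
  sweep l (linear_up K) top - sweep l (linear_up K) bot = \sum_u K u * gap l u.
Proof.
by rewrite !sweep_linear_up -sumrB; apply: eq_bigr => u _; rewrite mulrBr.
Qed.

(** A function whose variation in the spin at [u] is at most [K u] can be
    subtracted from [linear_up K] without destroying monotonicity. *)
Lemma sweep_lipschitz_gap l K g :
  (forall u s, g (upd u true s) - g (upd u false s) <= K u) ->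
  sweep l g top - sweep l g bot <= \sum_u K u * gap l u.
Proof.
move=> /linear_up_sub_increasing inc; rewrite -sweep_linear_up_gap.
have E s : sweep l (fun t => linear_up K t + -1 * g t) s =
    sweep l (linear_up K) s - sweep l g s.
  under eq_fun do rewrite addrC; rewrite sweep_linear; ring.
have := increasing_le_top bot (sweep_increasing l inc).
by rewrite !E; lra.
Qed.

(** The word kept to study the site [v] may depend on [v], since the gaps at
    different sites are bounded separately; summing over the sites first makes
    the column sums of [K] the relevant quantity. *)
Lemma total_gap_contract l1 l2 (c : V -> seq V) (K : V -> V -> R) kappa :
  (forall v, subseq (c v) l2) ->
  (forall v u s, sweep (c v) (up v) (upd u true s)
                 - sweep (c v) (up v) (upd u false s) <= K v u) ->
  (forall u, \sum_v K v u <= kappa) ->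
  total_gap (l1 ++ l2) <= kappa * total_gap l1.
Proof.
move=> cl cK Kk.
have gapK v : gap (l1 ++ l2) v <= \sum_u K v u * gap l1 u.
  have sub : subseq (l1 ++ c v) (l1 ++ l2) by exact: cat_subseq.
  apply: le_trans (sweep_lipschitz_gap l1 (cK v)).
  rewrite -!sweep_cat lerB ?censor_top ?censor_bot //; exact: up_increasing.
apply: le_trans (ler_sum _ (fun v _ => gapK v)) _.
rewrite exchange_big mulr_sumr /=; apply: ler_sum => u _.
by rewrite -mulr_suml ler_wpM2r ?gap_ge0.
Qed.

(** With [K] constantly [2], both [linear_up K + f] and [linear_up K - f] are
    increasing, hence between any two starting points the expectation of [f]
    varies at most as much as that of [linear_up K] varies between the extremal
    ones. *)
Lemma sweep_oscillation l f s t : (forall r, `|f r| <= 1) ->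
  sweep l f s - sweep l f t <= 2 * total_gap l.
Proof.
move=> f1; pose K := fun _ : V => 2 : R.
have fb r r' : f r - f r' <= 2.
  have := f1 r; have := f1 r'; rewrite !ler_norml => /andP[? ?] /andP[? ?]; lra.
have inc_minus : increasing (fun s => linear_up K s + -1 * f s).
  by apply: linear_up_sub_increasing.
(* [-1 * f + 0] has the shape to which [sweep_linear] applies. *)
have inc_plus : increasing (fun s => linear_up K s + -1 * (-1 * f s + 0)).
  apply: linear_up_sub_increasing => u r.
  by have := fb (upd u false r) (upd u true r); lra.
have Em r : sweep l (fun s => linear_up K s + -1 * f s) r =
    sweep l (linear_up K) r - sweep l f r.
  under eq_fun do rewrite addrC; rewrite sweep_linear; ring.
have Ep r : sweep l (fun s => linear_up K s + -1 * (-1 * f s + 0)) r =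
    sweep l (linear_up K) r + sweep l f r.
  under eq_fun do rewrite addrC; rewrite !sweep_linear sweep_const; ring.
have gapE : 2 * total_gap l = sweep l (linear_up K) top - sweep l (linear_up K) bot.
  by rewrite sweep_linear_up_gap mulr_sumr.
have up_p := increasing_le_top s (sweep_increasing l inc_plus).
have lo_p := increasing_ge_bot t (sweep_increasing l inc_plus).
have up_m := increasing_le_top t (sweep_increasing l inc_minus).
have lo_m := increasing_ge_bot s (sweep_increasing l inc_minus).
move: up_p lo_p up_m lo_m; rewrite !Em !Ep gapE; lra.
Qed.

Definition repeat_word (n : nat) l : seq V := flatten (nseq n l).

Lemma repeat_wordD m n l : repeat_word (m + n) l = repeat_word m l ++ repeat_word n l.
Proof. by rewrite /repeat_word nseqD flatten_cat. Qed.

Definition scan_word (phi : seq V) : seq V := phi ++ rev phi.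

Lemma total_gap_repeat l n k kappa : 0 <= kappa ->
  (forall l1, total_gap (l1 ++ repeat_word n l) <= kappa * total_gap l1) ->
  total_gap (repeat_word (n * k) l) <= kappa ^+ k * #|V|%:R.
Proof.
move=> k0 contract; elim: k => [|k IH]; first by rewrite muln0 total_gap_nil mul1r.
rewrite mulnS addnC repeat_wordD exprS -mulrA.
by apply: le_trans (contract _) _; rewrite ler_wpM2l.
Qed.

(** * Balls and tails of self-avoiding walks *)

Definition neighbours v : {set V} := [set u | e v u].

Fixpoint reach (k : nat) v w : bool :=
  (v == w) || (if k is m.+1 then [exists u, e v u && reach m u w] else false).

Definition graph_ball k v : {set V} := [set w | reach k v w].

Lemma graph_ball_self k v : v \in graph_ball k v.
Proof. by rewrite inE; case: k => [|k]; rewrite /= eqxx. Qed.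

Lemma graph_ball_step k v u w : e v u -> w \in graph_ball k u -> w \in graph_ball k.+1 v.
Proof.
rewrite !inE => vu uw; apply/orP; right; apply/existsP; exists u.
by rewrite vu.
Qed.

Lemma reach_rcons k v u w : reach k v u -> e u w -> reach k.+1 v w.
Proof.
elim: k v => [|k IH] v.
  rewrite /= orbF => /eqP -> uw; apply/orP; right; apply/existsP; exists w.
  by rewrite uw eqxx.
case/orP => [/eqP -> uw|/existsP[x /andP[vx xu]] uw].
  apply/orP; right; apply/existsP; exists w; rewrite uw.
  by have := graph_ball_self k.+1 w; rewrite inE.
by apply/orP; right; apply/existsP; exists x; rewrite vx; exact: IH.
Qed.

Lemma reach_sym k v w : reach k v w -> reach k w v.
Proof.
elim: k v => [|k IH] v; first by rewrite /= !orbF eq_sym.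
case/orP => [/eqP ->|/existsP[x /andP[vx xw]]].
  by have := graph_ball_self k.+1 w; rewrite inE.
by apply: reach_rcons (IH _ xw) _; rewrite e_sym.
Qed.

Lemma graph_ball_sym k v w : (w \in graph_ball k v) = (v \in graph_ball k w).
Proof. by rewrite !inE; apply/idP/idP; exact: reach_sym. Qed.

Lemma graph_ball_rcons k v u w : u \in graph_ball k v -> e u w -> w \in graph_ball k.+1 v.
Proof. by rewrite !inE; exact: reach_rcons. Qed.

(* The maximum degree is [D.+1], so that [D] counts the continuations of a walk
   that does not turn back. *)
Variable D : nat.
Hypothesis degD : forall v, (degree e v <= D.+1)%N.

Lemma card_neighbours v : (#|neighbours v| <= D.+1)%N.
Proof. exact: degD. Qed.

Lemma card_graph_ball k v : (#|graph_ball k v| <= D.+2 ^ k)%N.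
Proof.
elim: k v => [|k IH] v.
  rewrite expn0 -(cards1 v); apply: subset_leq_card.
  by apply/fintype.subsetP => w; rewrite !inE /= orbF eq_sym.
have sub : graph_ball k.+1 v \subset \bigcup_(u in v |: neighbours v) graph_ball k u.
  apply/fintype.subsetP => w; rewrite inE => /orP[/eqP <-|].
    by apply/finset.bigcupP; exists v; rewrite ?setU11 ?graph_ball_self.
  move=> /existsP[x /andP[vx xw]]; apply/finset.bigcupP; exists x; rewrite !inE //.
  by rewrite vx orbT.
have cup (A : {set V}) :
    (#|\bigcup_(u in A) graph_ball k u| <= \sum_(u in A) #|graph_ball k u|)%N.
  elim/big_rec2: _ => [|u n S _ nS]; first by rewrite cards0.
  by apply: leq_trans (leq_card_setU _ _) _; rewrite leq_add2l.
apply: leq_trans (subset_leq_card sub) _; apply: leq_trans (cup _) _.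
apply: (@leq_trans (\sum_(u in v |: neighbours v) D.+2 ^ k)); first exact: leq_sum.
rewrite sum_nat_const expnS leq_mul2r; apply/orP; right.
apply: leq_trans (leq_card_setU _ _) _.
by rewrite cards1 add1n ltnS card_neighbours.
Qed.

Local Notation rho := (theta * D%:R).
Hypothesis rho_lt1 : rho < 1.

Lemma saw_sumE n B w (X : {set V}) :
  \sum_(v in X) saw n.+1 B w v =
  (w \in X)%:R + theta * \sum_(x in B :\ w | e w x) \sum_(v in X) saw n (B :\ w) x v.
Proof.
rewrite /= big_split /= -mulr_sumr exchange_big /=; congr (_ + _).
have [wX|wX] := boolP (w \in X); last first.
  by rewrite big1 // => v vX; case: eqP => // wv; rewrite -wv (negPf wX) in vX.
rewrite (bigD1 w) //= eqxx big1 ?addr0 // => v /andP[_ /negPf].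
by rewrite eq_sym => ->.
Qed.

Lemma rho_ge0 : 0 <= rho.
Proof. by rewrite mulr_ge0 ?theta_ge0. Qed.

(** A walk that avoids the deleted vertex [p] has at most [D] continuations at
    each vertex, so the walks of length at least [k] have total weight at most
    a geometric tail of ratio [theta * D]. *)
Lemma saw_tail n B w p k (X : {set V}) :
  e w p -> p \notin B ->
  (forall v, v \in X -> (0 < k)%N -> v \notin graph_ball k.-1 w) ->
  \sum_(v in X) saw n B w v <= rho ^+ k / (1 - rho).
Proof.
have r0 := rho_ge0; have r1 : 0 < 1 - rho by rewrite subr_gt0.
elim: n B w p k => [|n IH] B w p k wp pB Xk.
  by rewrite big1 // divr_ge0 ?exprn_ge0 // ltW.
rewrite saw_sumE; pose nx : {set V} := [set x in B :\ w | e w x].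
have nxD : (#|nx| <= D)%N.
  have sub : p |: nx \subset neighbours w.
    by apply/fintype.subsetP => x; rewrite !inE => /orP[/eqP -> //|/andP[]].
  rewrite -ltnS; apply: leq_trans (card_neighbours w).
  by have := subset_leq_card sub; rewrite cardsU1 !inE (negPf pB) andbF.
have tail j : (forall x v, e w x -> v \in X -> (0 < j)%N -> v \notin graph_ball j.-1 x) ->
    theta * \sum_(x in B :\ w | e w x) \sum_(v in X) saw n (B :\ w) x v
      <= rho * (rho ^+ j / (1 - rho)).
  move=> Xj; rewrite -mulrA ler_wpM2l ?theta_ge0 //.
  have le_each x : x \in nx ->
      \sum_(v in X) saw n (B :\ w) x v <= rho ^+ j / (1 - rho).
    rewrite inE => /andP[xB wx]; apply: (IH _ _ w) => [||v vX].
    - by rewrite e_sym.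
    - by rewrite !inE eqxx.
    - exact: Xj.
  rewrite (eq_bigl [in nx]) => [|x]; last by rewrite [RHS]inE.
  apply: le_trans (ler_sum _ le_each) _.
  rewrite sumr_const -[_ *+ #|_|]mulr_natl ler_wpM2r ?ler_nat //.
  by rewrite divr_ge0 ?exprn_ge0 // ltW.
case: k Xk => [|k] Xk.
  apply: (@le_trans _ _ (1 + rho * (rho ^+ 0 / (1 - rho)))).
    by apply: lerD; [case: (w \in X); rewrite ?lexx ?ler01 | apply: tail].
  rewrite expr0 le_eqVlt; apply/orP; left; apply/eqP.
  by field; rewrite gt_eqF.
have -> : (w \in X) = false.
  by apply/negP => /Xk; rewrite /= graph_ball_self => /(_ isT).
rewrite add0r exprS -mulrA; apply: tail => x v wx vX; case: k Xk => //= k Xk _.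
by apply: contra (Xk v vX isT); exact: graph_ball_step.
Qed.

(** * Relaxation inside a block *)

Definition agree_on (M : {set V}) s t : Prop := forall x, x \in M -> s x = t x.

Definition local_function (M : {set V}) f : Prop :=
  forall s t, agree_on M s t -> f s = f t.

Lemma agree_on_upd M v a s t : agree_on M s t -> agree_on M (upd v a s) (upd v a t).
Proof. by move=> st x xM; rewrite !ffunE st. Qed.

Lemma site_update_local (M : {set V}) v f : neighbours v \subset M ->
  local_function M f -> local_function M (site_update v f).
Proof.
move=> vM fM s t st; rewrite !site_updateE.
rewrite (fM _ _ (agree_on_upd v true st)) (fM _ _ (agree_on_upd v false st)).
suff -> : plus_prob v s = plus_prob v t by [].
rewrite !plus_prob_logistic; congr (1 + expR (- (beta * _)))^-1.
apply: eq_bigr => x _; case vx: (e v x); last by rewrite !mul0r.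
by rewrite st // (fintype.subsetP vM) // inE.
Qed.

Lemma sweep_local (M : {set V}) l f : (forall v, v \in l -> neighbours v \subset M) ->
  local_function M f -> local_function M (sweep l f).
Proof.
move=> lM fM; elim: l lM => //= v l IH lM; apply: site_update_local.
  by apply: lM; rewrite inE eqxx.
by apply: IH => u ul; apply: lM; rewrite inE ul orbT.
Qed.

Lemma up_local (M : {set V}) v : v \in M -> local_function M (up v).
Proof. by move=> vM s t /(_ v vM); rewrite /up => ->. Qed.

Lemma local_upd (M : {set V}) f u a a' s : local_function M f -> u \notin M ->
  f (upd u a s) = f (upd u a' s).
Proof.
move=> fM uM; apply: fM => x xM.
by rewrite !upd_other //; apply: contraNneq uM => <-.
Qed.

(** The indicator of a fibre is unchanged by updates inside [B], so
    self-adjointness gives the tower property. *)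
Lemma cexp_site_update B v f s : v \in B ->
  cexp B nofield s (site_update v f) = cexp B nofield s f.
Proof.
move=> vB; pose ind t : R := (agree_outside B s t)%:R.
have num g : \sum_(t | agree_outside B s t) weight nofield t * g t = inner ind g.
  rewrite /inner big_mkcond; apply: eq_bigr => t _; rewrite /ind.
  by case: ifP => _; rewrite ?mulr1 // mulr0 mul0r.
have ind_v : site_update v ind = ind.
  apply/funext => t; rewrite site_updateE /ind !agree_outside_updr //; ring.
by rewrite /cexp !num inner_site_update ind_v.
Qed.

Lemma cexp_sweep B l f s : {subset l <= B} ->
  cexp B nofield s (sweep l f) = cexp B nofield s f.
Proof.
elim: l => //= v l IH lB; rewrite cexp_site_update ?lB ?inE ?eqxx //.
by apply: IH => u ul; rewrite lB // inE ul orbT.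
Qed.

(** The configuration reached when every update of the word produces a plus. *)
Definition fill l s : config V := foldl (fun t v => upd v true t) s l.

Lemma fillE l s u : fill l s u = (u \in l) || s u.
Proof.
elim: l s => //= v l IH s; rewrite IH ffunE inE.
by case: (u == v); rewrite ?orbT.
Qed.

Section BlockContraction.
Variable q : R.
Hypothesis q_ge0 : 0 <= q.
Hypothesis q_le_plus_prob : forall v s, q <= plus_prob v s.

(** Each update produces a plus with probability at least [q]. *)
Lemma sweep_ge_fill B l f s : {subset l <= B} ->
  (forall t, agree_outside B s t -> 0 <= f t) ->
  q ^+ size l * f (fill l s) <= sweep l f s.
Proof.
move=> lB f0.
suff [] : 0 <= sweep l f s /\ q ^+ size l * f (fill l s) <= sweep l f s by [].
elim: l s lB f0 => [|v l IH] s lB f0 /=.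
  by rewrite expr0 mul1r f0 ?agree_outside_refl.
have vB : v \in B by rewrite lB // inE eqxx.
have lB' : {subset l <= B} by move=> u ul; rewrite lB // inE ul orbT.
have sub a t : agree_outside B (upd v a s) t -> 0 <= f t.
  by move=> ut; apply: f0; apply: agree_outside_trans ut; exact: agree_outside_upd.
have [p0 pf] := IH _ lB' (sub true); have [m0 _] := IH _ lB' (sub false).
rewrite site_updateE; split; first by rewrite addr_ge0 // mulr_ge0 ?plus_prob_ge0 ?plus_prob_le1.
rewrite exprS -mulrA -[leLHS]addr0 lerD //; last by rewrite mulr_ge0 ?plus_prob_le1.
apply: le_trans (ler_wpM2l q_ge0 pf) _; rewrite ler_wpM2r //.
Qed.

Definition fiber_range B s f (m c : R) : Prop :=
  forall t, agree_outside B s t -> m <= f t <= m + c.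

(** A Doeblin argument: from every point of a fibre there is a chance of at least
    [q ^+ size l] of ending at the same configuration, all plus on [B]. *)
Lemma sweep_fiber_range B l f s (m c : R) : l =i B -> fiber_range B s f m c ->
  exists m', fiber_range B s (sweep l f) m' ((1 - q ^+ size l) * c).
Proof.
move=> lB fr; have lB' : {subset l <= B} by move=> u; rewrite lB.
exists (m + q ^+ size l * (f (fill l s) - m)) => t st.
have -> : fill l s = fill l t.
  apply/ffunP => u; rewrite !fillE lB; have [//|uB] := boolP (u \in B).
  by move/agree_outsideP: st => ->.
have tr r : agree_outside B t r -> agree_outside B s r by exact: agree_outside_trans.
have lo := @sweep_ge_fill B l (fun r => 1 * f r + - m) t lB'.
have hi := @sweep_ge_fill B l (fun r => -1 * f r + (m + c)) t lB'.
have {}lo := lo (fun r tr' => ltac:(by have /andP[] := fr _ (tr _ tr'); lra)).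
have {}hi := hi (fun r tr' => ltac:(by have /andP[] := fr _ (tr _ tr'); lra)).
move: lo hi; rewrite !sweep_linear !sweep_const.
move: (q ^+ _) (f _) (sweep _ _ _) => x y z; lra.
Qed.

Lemma fiber_range_repeat B l f s (m c : R) n : l =i B -> fiber_range B s f m c ->
  exists m', fiber_range B s (sweep (repeat_word n l) f) m' ((1 - q ^+ size l) ^+ n * c).
Proof.
move=> lB fr; elim: n => [|n [m' IH]]; first by exists m; rewrite expr0 mul1r.
have -> : repeat_word n.+1 l = l ++ repeat_word n l by [].
rewrite sweep_cat exprS -mulrA; exact: sweep_fiber_range IH.
Qed.

(** The conditional expectation is unchanged by the updates in [B] and lies in the
    range of values on the fibre, which shrinks geometrically. *)
Lemma sweep_repeat_cexp B l v s n : l =i B ->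
  `|sweep (repeat_word n l) (up v) s - cexp B nofield s (up v)|
    <= (1 - q ^+ size l) ^+ n.
Proof.
move=> lB; have fr : fiber_range B s (up v) 0 1.
  by move=> t _; rewrite /up; case: (t v); rewrite ?lexx ?add0r ?ler01 ?lexx.
have [m fm] := fiber_range_repeat n lB fr.
rewrite mulr1 in fm.
rewrite -(@cexp_sweep B (repeat_word n l)); last first.
  move=> u /flattenP[k /nseqP[-> _]]; by rewrite lB.
have /andP[h1 h2] := fm s (agree_outside_refl _ _).
have h3 : m <= cexp B nofield s (sweep (repeat_word n l) (up v)).
  by apply: cexp_ge => t /fm /andP[].
have h4 : cexp B nofield s (sweep (repeat_word n l) (up v)) <= m + (1 - q ^+ size l) ^+ n.
  by apply: cexp_le => t /fm /andP[].
rewrite ler_norml; lra.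
Qed.

End BlockContraction.

(** * Contraction of the gap *)

Lemma sum_neighbours (F : V -> R) u :
  \sum_v (e v u)%:R * F v = \sum_(v in neighbours u) F v.
Proof.
rewrite [RHS]big_mkcond; apply: eq_bigr => v _; rewrite inE e_sym.
by case: (e u v); rewrite ?mul1r ?mul0r.
Qed.

(** The Dobrushin regime: a single update at [v] is kept, and the only
    self-avoiding walks in a one-point block are trivial. *)
Lemma total_gap_dobrushin l1 l : (forall v, v \in l) ->
  total_gap (l1 ++ l) <= theta * D.+1%:R * total_gap l1.
Proof.
move=> lV; apply: (@total_gap_contract _ _ (fun v => [:: v])
    (fun v u => (e v u)%:R * theta)) => [v|v u s|u].
- by rewrite sub1seq.
- rewrite /= /site_update; have [->|uv] := eqVneq u v.
    by rewrite -!/(plus_prob _ _) !plus_prob_upd subrr mulr_ge0 ?theta_ge0.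
  apply: le_trans (@flip_influence 1 [set v] u v nofield s _ _ _) _.
  + by rewrite cards1.
  + by rewrite inE.
  + by rewrite eq_sym.
  rewrite mulrC ler_wpM2r ?theta_ge0 // big_mkcondr big_set1 e_sym.
  case: (e v u) => //=; rewrite eqxx big1 ?mulr0 ?addr0 // => x.
- rewrite sum_neighbours sumr_const -[_ *+ #|_|]mulr_natr ler_wpM2l ?theta_ge0 //.
  by rewrite ler_nat card_neighbours.
Qed.

Lemma plus_prob_lower beta1 v s : beta <= beta1 -> (1 + expR (beta1 * D.+1%:R))^-1 <= plus_prob v s.
Proof.
move=> bbeta1; rewrite plus_prob_logistic lef_pV2 ?posrE ?addr_gt0 ?expR_gt0 //.
rewrite lerD2l ler_expR -mulrN; apply: (@le_trans _ _ (beta * D.+1%:R)).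
  rewrite ler_wpM2l // -sumrN; apply: (@le_trans _ _ (\sum_x (e v x)%:R)).
    apply: ler_sum => x _; rewrite /spin.
    by case: (e v x); case: (s x) => /=; lra.
  rewrite -natr_sum ler_nat; apply: leq_trans (card_neighbours v).
  rewrite -sum1_card [leqRHS]big_mkcond /=; apply: leq_sum => x _.
  by rewrite inE; case: (e v x).
by rewrite ler_wpM2r.
Qed.

Section BlockUpdates.
Variables (q : R) (phi : seq V) (r N : nat).
Hypothesis q01 : 0 <= q <= 1.
Hypothesis q_le_plus_prob : forall v s, q <= plus_prob v s.
Hypothesis phiV : perm_eq phi (enum V).

Let scan := scan_word phi.
(* [M] bounds the cardinality of the blocks and of their closed neighbourhoods;
   a block is updated at most [M + M] times in each symmetrized scan. *)
Let M := (D.+2 ^ r.+1)%N.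
Let err := (1 - q ^+ (M + M)) ^+ N.

Lemma mem_scan v : v \in scan.
Proof. by rewrite mem_cat (perm_mem phiV) mem_enum. Qed.

Lemma size_filter_scan (B : {set V}) : size [seq x <- scan | x \in B] = (#|B| + #|B|)%N.
Proof.
have E : size [seq x <- phi | x \in B] = #|B|.
  rewrite cardE; apply: perm_size; apply: uniq_perm.
  - by rewrite filter_uniq // (perm_uniq phiV) enum_uniq.
  - exact: enum_uniq.
  - by move=> v; rewrite mem_filter (perm_mem phiV) !mem_enum andbT.
by rewrite filter_cat filter_rev size_cat size_rev E.
Qed.

Definition block_word v : seq V := repeat_word N [seq x <- scan | x \in graph_ball r v].

Lemma block_word_subseq v : subseq (block_word v) (repeat_word N scan).
Proof.
have -> : block_word v = [seq x <- repeat_word N scan | x \in graph_ball r v].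
  by rewrite /block_word /repeat_word filter_flatten map_nseq.
exact: filter_subseq.
Qed.

Lemma block_word_cexp v s :
  `|sweep (block_word v) (up v) s - cexp (graph_ball r v) nofield s (up v)| <= err.
Proof.
have /andP[q0 q1] := q01.
have lB : [seq x <- scan | x \in graph_ball r v] =i graph_ball r v.
  by move=> u; rewrite mem_filter mem_scan andbT.
apply: le_trans (sweep_repeat_cexp q0 q_le_plus_prob v s N lB) _.
have sz : (size [seq x <- scan | x \in graph_ball r v] <= M + M)%N.
  rewrite size_filter_scan; have h : (#|graph_ball r v| <= M)%N.
    apply: leq_trans (card_graph_ball _ _) _; exact: leq_pexp2l.
  exact: leq_add.
rewrite lerXn2r ?nnegrE ?subr_ge0 ?exprn_ile1 //.
by rewrite lerD2l lerN2 ler_wiXn2l.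
Qed.

(** The first term is the equilibrium influence of a spin outside the ball; walks
    are counted in the whole graph minus [u] rather than in the ball, so that the
    bound can be summed over [v]. The second one is the relaxation error, which
    only spins in or next to the ball can feel. *)
Definition block_influence v u : R :=
  (u \notin graph_ball r v)%:R *
    (theta * \sum_(x in ~: [set u] | e u x) saw #|V| (~: [set u]) x v)
  + (u \in graph_ball r.+1 v)%:R * (2 * err).

(** The word is within [err] of the conditional expectation at both spin values,
    and the latter depends on the spin at [u] only when [u] is frozen. *)
Lemma block_word_influence v u s :
  sweep (block_word v) (up v) (upd u true s) -
  sweep (block_word v) (up v) (upd u false s) <= block_influence v u.
Proof.
rewrite /block_influence; set S := \sum_(x in _ | _) _.
have S0 : 0 <= theta * S.
  by rewrite mulr_ge0 ?theta_ge0 // sumr_ge0 // => x _; exact: saw_ge0.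
have e0 : 0 <= err.
  by apply: le_trans (block_word_cexp v s); exact: normr_ge0.
have [uB|uB] := boolP (u \in graph_ball r.+1 v); last first.
  rewrite (@local_upd (graph_ball r.+1 v) _ u true false) //.
    by rewrite subrr mul0r addr0 mulr_ge0.
  apply: sweep_local; last by apply: up_local; exact: graph_ball_self.
  move=> x /flattenP[k /nseqP[-> _]]; rewrite mem_filter => /andP[xB _].
  by apply/fintype.subsetP => y; rewrite inE; exact: graph_ball_rcons.
have := block_word_cexp v (upd u true s).
have := block_word_cexp v (upd u false s).
rewrite !ler_norml mul1r => /andP[h1 h2] /andP[h3 h4].
suff : cexp (graph_ball r v) nofield (upd u true s) (up v) -
       cexp (graph_ball r v) nofield (upd u false s) (up v)
       <= (u \notin graph_ball r v)%:R * (theta * S) by lra.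
have [uBr|uBr] := boolP (u \in graph_ball r v).
  rewrite (@cexp_agree _ _ _ (upd u false s)) ?subrr ?mul0r //.
  apply: agree_outside_trans (agree_outside_upd _ _ uBr).
  by rewrite agree_outside_sym agree_outside_upd.
rewrite mul1r; apply: le_trans (flip_influence nofield s (max_card _) uBr _) _.
  by apply: contraNneq uBr => <-; exact: graph_ball_self.
have sub : graph_ball r v \subset ~: [set u].
  by apply/fintype.subsetP => x xB; rewrite !inE; apply: contraNneq uBr => <-.
rewrite ler_wpM2l ?theta_ge0 // big_mkcond [leRHS]big_mkcond.
apply: ler_sum => x _; case: ifPn => [/andP[xB ux]|_].
  by rewrite (fintype.subsetP sub) // ux /= saw_subset.
by case: ifP => // _; exact: saw_ge0.
Qed.

(** If [u] lies outside the ball around [v], then [v] lies outside the ball around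
    [u], so the first terms add up to a tail of the walks starting at [u]. *)
Lemma block_influence_col u :
  \sum_v block_influence v u <=
  theta * D.+1%:R * (rho ^+ r / (1 - rho)) + 2 * err * M%:R.
Proof.
have r0 := rho_ge0; have r1 : 0 < 1 - rho by rewrite subr_gt0.
have e0 : 0 <= err.
  by apply: le_trans (block_word_cexp u top); exact: normr_ge0.
rewrite big_split /=; apply: lerD; last first.
  rewrite -mulr_suml mulrC ler_wpM2l ?mulr_ge0 //.
  rewrite -natr_sum ler_nat; apply: leq_trans (card_graph_ball r.+1 u).
  rewrite -sum1_card [leqRHS]big_mkcond /=; apply: leq_sum => v _.
  by rewrite graph_ball_sym; case: (v \in _).
pose X := [set v | v \notin graph_ball r u].
have E v : (u \notin graph_ball r v)%:R *
      (theta * \sum_(x in ~: [set u] | e u x) saw #|V| (~: [set u]) x v) =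
    if v \in X then theta * \sum_(x in ~: [set u] | e u x) saw #|V| (~: [set u]) x v
    else 0.
  have -> : (v \in X) = (u \notin graph_ball r v).
    by rewrite [LHS]finset.in_set graph_ball_sym.
  by case: (u \notin _); rewrite ?mul1r ?mul0r.
rewrite (eq_bigr _ (fun v _ => E v)) -big_mkcond /= -mulr_sumr exchange_big /=.
rewrite -mulrA ler_wpM2l ?theta_ge0 //.
have le_each x : x \in neighbours u ->
    \sum_(v in X) saw #|V| (~: [set u]) x v <= rho ^+ r / (1 - rho).
  rewrite inE => ux; apply: (@saw_tail _ _ _ u).
  - by rewrite e_sym.
  - by rewrite !inE eqxx.
  - move=> v; rewrite finset.in_set => vX r_gt0; apply: contra vX => vx.
    by rewrite -(prednK r_gt0); exact: graph_ball_step vx.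
rewrite (eq_bigl [in neighbours u]) => [|x]; last first.
  rewrite !inE andb_idl // => ux; apply/eqP => xu.
  by rewrite xu e_irr in ux.
apply: le_trans (ler_sum _ le_each) _.
rewrite sumr_const -[_ *+ #|_|]mulr_natl ler_wpM2r ?ler_nat ?card_neighbours //.
by rewrite divr_ge0 ?exprn_ge0 // ltW.
Qed.

Lemma total_gap_block l1 :
  total_gap (l1 ++ repeat_word N scan) <=
  (theta * D.+1%:R * (rho ^+ r / (1 - rho)) + 2 * err * M%:R) * total_gap l1.
Proof.
apply: total_gap_contract block_word_subseq _ block_influence_col.
exact: block_word_influence.
Qed.

End BlockUpdates.

(** * The transition matrices and the total variation distance *)

Lemma sum_edges (F : {set V} -> R) :
  2 * \sum_(f in edges e) F f = \sum_x \sum_y (e x y)%:R * F [set x; y].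
Proof.
rewrite pair_bigA /= (bigID (fun p : V * V => e p.1 p.2)) /=.
rewrite [X in _ + X]big1 ?addr0 => [|p /negPf ->]; last by rewrite mul0r.
rewrite (partition_big (fun p : V * V => [set p.1; p.2]) [in edges e]) /=; last first.
  by move=> p ep; apply/imsetP; exists p; rewrite ?inE.
rewrite mulr_sumr; apply: eq_bigr => f /imsetP[[x y]]; rewrite inE /= => exy ->.
have xy : x != y by apply: contraTneq exy => ->; rewrite e_irr.
have E (p : V * V) : e p.1 p.2 && ([set p.1; p.2] == [set x; y]) =
    (p \in [set (x, y); (y, x)]).
  case: p => a b /=; rewrite !inE !xpair_eqE.
  apply/andP/orP => [[eab /eqP ab]|].
    have := set21 a b; have := set22 a b; rewrite ab !inE.
    have ne : a != b by apply: contraTneq eab => ->; rewrite e_irr.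
    move=> /orP[]/eqP bE /orP[]/eqP aE; move: ne; rewrite aE bE ?eqxx //=.
      by right.
    by left.
  case=> /andP[/eqP -> /eqP ->]; first by rewrite exy eqxx.
  by rewrite e_sym exy finset.setUC eqxx.
rewrite (eq_bigl _ _ E) big_setU1 ?big_set1 /=; last first.
  by rewrite inE xpair_eqE negb_and xy.
rewrite exy (e_sym y) exy (finset.setUC [set y]) !mul1r; ring.
Qed.

Lemma monochromatic_pair s x y : monochromatic s [set x; y] = (s x == s y).
Proof.
apply/forall_inP/eqP => [h|sxy u].
  by have /forall_inP/(_ y (set22 _ _))/eqP := h x (set21 _ _).
by rewrite !inE => /orP[]/eqP ->; apply/forall_inP => v;
  rewrite !inE => /orP[]/eqP ->; rewrite ?sxy eqxx.
Qed.

Lemma hamiltonian_energy s :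
  - hamiltonian e beta s = beta / 4 * (\sum_x \sum_y (e x y)%:R) + energy s.
Proof.
rewrite /hamiltonian mulNr opprK /energy -mulrDr -big_split /=.
transitivity (beta / 2 * (2 * \sum_(f in edges e) (monochromatic s f)%:R : R)).
  by field.
rewrite sum_edges !mulr_sumr; apply: eq_bigr => x _.
rewrite -big_split /= !mulr_sumr; apply: eq_bigr => y _.
by rewrite monochromatic_pair /spin; case: (s x); case: (s y) => /=; field.
Qed.

Lemma ising_weight : exists2 k : R, 0 < k &
  forall s, ising e beta s = k * weight nofield s.
Proof.
pose c := expR (beta / 4 * (\sum_x \sum_y (e x y)%:R)).
have Z0 : 0 < partition_function e beta.
  rewrite /partition_function (bigD1 top) //= ltr_pwDl ?expR_gt0 //.
  by apply: sumr_ge0 => s _; exact: expR_ge0.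
exists (c / partition_function e beta); first by rewrite divr_gt0 ?expR_gt0.
move=> s; rewrite /ising hamiltonian_energy expRD -/c /weight.
rewrite [X in energy s + X]big1 ?addr0 => [|x _]; last by rewrite mul0r.
by rewrite mulrAC.
Qed.

Lemma ising_ge0 s : 0 <= ising e beta s.
Proof.
by have [k k0 ->] := ising_weight; rewrite mulr_ge0 ?ltW ?weight_gt0.
Qed.

Lemma sum_ising : \sum_s ising e beta s = 1.
Proof.
have Z0 : 0 < partition_function e beta.
  rewrite /partition_function (bigD1 top) //= ltr_pwDl ?expR_gt0 //.
  by apply: sumr_ge0 => s _; exact: expR_ge0.
by rewrite /ising -mulr_suml divff ?gt_eqF.
Qed.

Definition column f : 'cV[R]_#|config V| := \col_i f (enum_val i).

Lemma heat_bath_column v f :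
  heat_bath (ising e beta) v *m column f = column (site_update v f).
Proof.
have [k k0 kE] := ising_weight; apply/colP => i; rewrite !mxE.
set s := enum_val i; pose F t := (if agree_outside [set v] s t then
  ising e beta t / \sum_(r | agree_off v s r) ising e beta r else 0) * f t.
rewrite (eq_bigr (fun j => F (enum_val j))) => [|j _]; last first.
  by rewrite !mxE /= agree_offE.
rewrite -big_enum_val /= /site_update /cexp mulr_suml [RHS]big_mkcond /=.
have den : \sum_(r | agree_off v s r) ising e beta r =
    k * \sum_(r | agree_outside [set v] s r) weight nofield r.
  by rewrite mulr_sumr; apply: eq_big => r; rewrite ?agree_offE.
apply: eq_bigr => t _; rewrite /F den; case: ifP; rewrite ?mul0r // => _.
by rewrite kE -mulf_div divff ?mul1r ?gt_eqF // mulrAC.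
Qed.

Lemma prod_heat_bath_column l f :
  (\prod_(v <- l) heat_bath (ising e beta) v : 'M[R]_#|config V|) *m column f
  = column (sweep l f).
Proof.
elim: l => [|v l IH]; first by rewrite big_nil mul1mx.
by rewrite big_cons -mulmxA IH heat_bath_column.
Qed.

Lemma scan_column phi (t : nat) f :
  symmetrized_scan (ising e beta) phi ^+ t *m column f =
  column (sweep (repeat_word t (scan_word phi)) f).
Proof.
elim: t => [|t IH]; first by rewrite expr0 mul1mx.
by rewrite exprS -mulmxA IH -mulmxA !prod_heat_bath_column -!sweep_cat.
Qed.

Lemma ising_stationary l f :
  \sum_s ising e beta s * sweep l f s = \sum_s ising e beta s * f s.
Proof.
have [k k0 kE] := ising_weight.
have E g : \sum_s ising e beta s * g s = k * inner (fun=> 1) g.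
  by rewrite mulr_sumr; apply: eq_bigr => s _; rewrite kE mulr1 mulrA.
elim: l => //= v l IH; rewrite -IH !E inner_site_update; congr (_ * inner _ _).
exact/funext/(sweep_const [:: v]).
Qed.

(** Testing against the sign of [P ^+ t x - mu], which has absolute value at
    most one. *)
Lemma max_tv_scan_le phi (t : nat) :
  max_tv (symmetrized_scan (ising e beta) phi) (ising e beta) t
    <= total_gap (repeat_word t (scan_word phi)).
Proof.
set l := repeat_word t _; have gap0 := total_gap_ge0 l.
apply/bigmax_leP; split=> // x _; rewrite /tv_dist.
pose p y := (symmetrized_scan (ising e beta) phi ^+ t) (enum_rank x) (enum_rank y).
rewrite -[X in _ * X]/(\sum_y `|p y - ising e beta y|).
pose f y := Num.sg (p y - ising e beta y).
have pf : \sum_y p y * f y = sweep l f x.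
  have /colP/(_ (enum_rank x)) := scan_column phi t f.
  rewrite !mxE enum_rankK => <-.
  pose F y := p y * f y; rewrite (eq_bigr (fun j => F (enum_val j))).
    by rewrite -big_enum_val.
  by move=> j _; rewrite !mxE /F /p enum_valK.
have E : \sum_y `|p y - ising e beta y| =
    \sum_y ising e beta y * (sweep l f x - sweep l f y).
  under [RHS]eq_bigr => y _ do rewrite mulrBr.
  rewrite sumrB -mulr_suml sum_ising mul1r ising_stationary -pf -sumrB.
  by apply: eq_bigr => y _; rewrite -mulrBl mulrC -normrEsg.
rewrite E ler_pdivrMl //.
apply: (@le_trans _ _ (\sum_y ising e beta y * (2 * total_gap l))).
  apply: ler_sum => y _; apply: ler_wpM2l; first exact: ising_ge0.
  apply: sweep_oscillation => r; rewrite normr_sg.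
  by case: (_ != 0).
by rewrite -mulr_suml sum_ising mul1r.
Qed.

End Gibbs.

(** * Numerical constants *)

Section Constants.
Context {R : realType}.

Lemma small_multiple_power (x c : R) : 0 <= x < 1 -> 0 <= c ->
  exists n : nat, c * x ^+ n <= 4^-1.
Proof.
move=> /andP[x0 x1] c0; have x1' : `|x| < 1 by rewrite ger0_norm.
have eps0 : 0 < (4 * (c + 1))^-1 by rewrite invr_gt0 mulr_gt0 ?ltr_wpDl.
have /cvgrPdist_le/(_ _ eps0)[n _ /(_ n (leqnn n))] := cvg_expr x1'.
rewrite sub0r normrN ger0_norm ?exprn_ge0 // => h; exists n.
apply: le_trans (ler_wpM2l c0 h) _.
rewrite ler_pdivrMr ?mulr_gt0 ?ltr_wpDl //; lra.
Qed.

(** With [3 * ln n / - ln kappa] steps the factor [kappa ^+ k] is at most [n ^- 3], and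
    [n ^- 2 <= 1 / 9]; rounding up adds one step, absorbed by [ln n / ln 3 >= 1]. *)
Lemma log_steps (kappa : R) (n : nat) : 0 < kappa < 1 -> (3 <= n)%N ->
  exists2 k : nat, (0 < k)%N & kappa ^+ k * n%:R <= 4^-1 /\
    k%:R <= (3 / (- ln kappa) + (ln 3)^-1) * ln n%:R.
Proof.
move=> /andP[k0 k1] n3; have L0 : 0 < - ln kappa by rewrite oppr_gt0 ln_lt0 ?k0.
have n3R : 3 <= n%:R :> R by rewrite ler_nat.
have n0 : 0 < n%:R :> R by apply: lt_le_trans n3R.
have ln3 : 0 < ln 3 :> R by rewrite ln_gt0 // ltr1n.
have ln3n : ln 3 <= ln n%:R :> R by rewrite ler_ln ?posrE.
have lnn0 := lt_le_trans ln3 ln3n.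
pose y := 3 * ln n%:R / - ln kappa; have y0 : 0 <= y.
  by rewrite divr_ge0 ?mulr_ge0 // ltW.
exists (Num.truncn y).+1 => //; have /andP[ky yk] := truncn_itv y0; split.
  have h : kappa ^+ (Num.truncn y).+1 <= (n%:R ^+ 3)^-1.
    rewrite -ler_ln ?posrE ?exprn_gt0 ?invr_gt0 ?exprn_gt0 //.
    rewrite lnV ?posrE ?exprn_gt0 // !lnXn //.
    rewrite -[ln kappa *+ _]mulr_natl -[ln n%:R *+ 3]mulr_natl.
    by move: yk; rewrite /y ltr_pdivrMr // => /ltW; rewrite mulrN lerNr.
  apply: le_trans (ler_wpM2r (ltW n0) h) _.
  rewrite mulrC ler_pdivrMr ?exprn_gt0 //.
  have : 9 <= n%:R ^+ 2 :> R by rewrite -natrX ler_nat (leq_sqr 3).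
  by rewrite exprSr => h9; have := ler_wpM2r (ltW n0) h9; lra.
rewrite -addn1 natrD mulrDl lerD //.
  by apply: le_trans ky _; rewrite /y mulrAC.
by rewrite mulrC ler_pdivlMr // mul1r.
Qed.

(** Convexity of the exponential between [0] and [y], from its tangent at
    [a * y]. *)
Lemma expR_convex0 (a y : R) : 0 <= a <= 1 -> expR (a * y) <= 1 + a * (expR y - 1).
Proof.
move=> /andP[a0 a1]; set m := a * y.
have h1 : expR m * (1 + (y - m)) <= expR y.
  have -> : expR y = expR m * expR (y - m) by rewrite -expRD addrC subrK.
  by rewrite ler_wpM2l ?expR_ge0 ?expR_ge1Dx.
have h0 : expR m * (1 - m) <= 1.
  have E : expR m * expR (- m) = 1 by rewrite -expRD subrr expR0.
  by rewrite -[leRHS]E ler_wpM2l ?expR_ge0 ?expR_ge1Dx.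
have a1' : 0 <= 1 - a by rewrite subr_ge0.
have := ler_wpM2l a0 h1; have := ler_wpM2l a1' h0; rewrite /m.
move: (expR _) (expR _) => u w; nra.
Qed.

Lemma theta_le (beta beta1 : R) : beta <= beta1 -> theta beta <= theta beta1.
Proof.
move=> bb; rewrite /theta; have := expR_gt0 beta; have := expR_gt0 beta1.
have : expR beta <= expR beta1 by rewrite ler_expR.
move: (expR _) (expR _) => u w uw w0 u0.
rewrite ler_pdivrMr ?addr_gt0 // mulrAC ler_pdivlMr ?addr_gt0 //; lra.
Qed.

Lemma expR_beta_u2 (Delta : nat) : (3 <= Delta)%N ->
  expR (beta_u2 R Delta) = Delta%:R / (Delta%:R - 2).
Proof.
move=> D3; have D3R : 3 <= Delta%:R :> R by rewrite ler_nat.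
by rewrite /beta_u2 lnK // posrE divr_gt0 //; lra.
Qed.

Lemma beta_u2_gt0 (Delta : nat) : (3 <= Delta)%N -> 0 < beta_u2 R Delta.
Proof.
move=> D3; have D3R : 3 <= Delta%:R :> R by rewrite ler_nat.
by rewrite /beta_u2 ln_gt0 // ltr_pdivlMr; lra.
Qed.

(** [theta] reaches [(Delta - 1)^-1] exactly at the uniqueness threshold. *)
Lemma theta_subcritical (delta : R) (D : nat) : 0 < delta < 1 -> (2 <= D)%N ->
  theta ((1 - delta) * beta_u2 R D.+1) * D%:R < 1.
Proof.
move=> /andP[d0 d1] D2; have D2R : 2 <= D%:R :> R by rewrite ler_nat.
have b0 := beta_u2_gt0 (D2 : 3 <= D.+1)%N.
have : expR ((1 - delta) * beta_u2 R D.+1) < D.+1%:R / (D.+1%:R - 2).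
  rewrite -expR_beta_u2 // ltr_expR; nra.
rewrite /theta; have := expR_gt0 ((1 - delta) * beta_u2 R D.+1).
move: (expR _) => y y0; rewrite -natr1 ltr_pdivlMr; last by lra.
by move=> h; rewrite mulrAC ltr_pdivrMr ?addr_gt0 //; lra.
Qed.

(** For [beta = (1 - delta) * beta_u2 R Delta], convexity bounds [expR beta] by
    [1 + (1 - delta) * 2 / (Delta - 2)], and [theta beta] is at most
    [(expR beta - 1) / 2]; so the product is at most
    [(1 - delta) * Delta / (Delta - 2)], which is where [4 / delta] comes from. *)
Lemma theta_dobrushin (delta : R) (Delta : nat) : 0 < delta < 1 ->
  (3 <= Delta)%N -> 4 / delta <= Delta%:R ->
  theta ((1 - delta) * beta_u2 R Delta) * Delta%:R <= 1 - delta / 2.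
Proof.
move=> /andP[d0 d1] D3; have D3R : 3 <= Delta%:R :> R by rewrite ler_nat.
rewrite ler_pdivrMr // => big.
have a01 : 0 <= 1 - delta <= 1 by apply/andP; split; lra.
have := expR_convex0 (beta_u2 R Delta) a01; rewrite expR_beta_u2 //.
have D2 : 0 < Delta%:R - 2 :> R by lra.
have b0 : 0 <= (1 - delta) * beta_u2 R Delta.
  by rewrite mulr_ge0 ?ltW ?beta_u2_gt0 //; lra.
have := expR_beta_ge1 b0.
rewrite /theta; move: (expR _) => y y1.
have -> : Delta%:R / (Delta%:R - 2) - 1 = 2 / (Delta%:R - 2) :> R.
  by field; rewrite gt_eqF.
rewrite mulrA -lerBlDl ler_pdivlMr // => hy.
apply: (@le_trans _ _ ((y - 1) / 2 * Delta%:R)).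
  rewrite ler_wpM2r // ler_wpM2l ?subr_ge0 // lef_pV2 ?posrE //; lra.
nra.
Qed.

End Constants.
(** * Mixing times *)

Section Mixing.
Context {R : realType}.

Lemma mixing_time_exists (Omega : finType) (P : 'M[R]_#|Omega|) (mu : Omega -> R)
    (t : nat) : (0 < t)%N -> max_tv P mu t <= 4^-1 ->
  exists2 T : nat, is_mixing_time P mu T & (T <= t)%N.
Proof.
move=> t0 tP; pose mixed s := (0 < s)%N && (max_tv P mu s <= 4^-1).
have ex : exists s, mixed s by exists t; rewrite /mixed t0.
case: (ex_minnP ex) => T /andP[T0 TP] Tmin; exists T; last first.
  by apply: Tmin; rewrite /mixed t0.
by split=> // s s0 sP; apply: Tmin; rewrite /mixed s0.
Qed.

Lemma mixing_time_contraction (V : finType) (e : rel V) (beta kappa : R)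
    (phi : seq V) (N : nat) :
  simple_graph e -> 0 <= beta -> 0 < kappa < 1 -> (0 < N)%N -> (3 <= #|V|)%N ->
  (forall l, total_gap (e := e) beta (l ++ repeat_word N (scan_word phi))
             <= kappa * total_gap (e := e) beta l) ->
  exists T : nat,
    is_mixing_time (symmetrized_scan (ising e beta) phi) (ising e beta) T /\
    T%:R <= N%:R * (3 / (- ln kappa) + (ln 3)^-1) * ln (#|V|%:R : R).
Proof.
move=> [e_sym e_irr] beta0 k01 N0 V3 contract.
have [k k0 [gap_small k_le]] := log_steps k01 V3.
have /andP[/ltW k_ge0 _] := k01.
have tv : max_tv (symmetrized_scan (ising e beta) phi) (ising e beta) (N * k) <= 4^-1.
  apply: le_trans (max_tv_scan_le e_sym e_irr beta0 _ _) _.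
  exact: le_trans (total_gap_repeat k k_ge0 contract) gap_small.
have Nk : (0 < N * k)%N by rewrite muln_gt0 N0.
have [T TP TNk] := mixing_time_exists Nk tv; exists T; split=> //.
rewrite -mulrA; apply: (@le_trans _ _ (N * k)%:R); first by rewrite ler_nat.
by rewrite natrM ler_wpM2l.
Qed.

Definition mixes_logarithmically (delta : R) (Delta : nat) (C : R) : Prop :=
  forall (beta : R) (V : finType) (e : rel V) (phi : seq V),
    (3 <= Delta)%N ->
    0 < beta < (1 - delta) * beta_u2 R Delta ->
    simple_graph e ->
    max_degree e = Delta ->
    vertex_ordering phi ->
    exists T : nat,
      is_mixing_time (symmetrized_scan (ising e beta) phi) (ising e beta) T
      /\ T%:R <= C * ln (#|V|%:R : R).

Lemma degree_le_max (V : finType) (e : rel V) v : (degree e v <= max_degree e)%N.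
Proof. exact: leq_bigmax. Qed.

Lemma max_degree_le_card (V : finType) (e : rel V) : (max_degree e <= #|V|)%N.
Proof. by apply/bigmax_leqP => v _; exact: max_card. Qed.

Lemma ler_mixes_logarithmically delta Delta (C C' : R) : C <= C' ->
  mixes_logarithmically delta Delta C -> mixes_logarithmically delta Delta C'.
Proof.
move=> CC' mix beta V e phi D3 hb sg hD ord.
have [T [TP TC]] := mix beta V e phi D3 hb sg hD ord.
exists T; split=> //; apply: le_trans TC _; rewrite ler_wpM2r // ln_ge0 //.
by rewrite ler1n; apply: leq_trans (max_degree_le_card e); rewrite hD; lia.
Qed.

(** For large degrees, the Dobrushin condition holds with a margin that depends
    on [delta] alone. *)
Lemma mixes_large_degree (delta : R) : 0 < delta < 1 ->
  exists C, forall Delta : nat, 4 / delta <= Delta%:R ->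
    mixes_logarithmically delta Delta C.
Proof.
move=> d01; have /andP[d0 d1] := d01; pose kappa := 1 - delta / 2.
have k01 : 0 < kappa < 1 by apply/andP; rewrite /kappa; split; lra.
exists (1%:R * (3 / (- ln kappa) + (ln 3)^-1)) => Delta big beta V e phi D3.
move=> /andP[b0 bu] sg hD ord; have [e_sym e_irr] := sg.
apply: mixing_time_contraction => //; first exact: ltW.
  by apply: leq_trans (max_degree_le_card e); rewrite hD.
move=> l; have scanV v : v \in repeat_word 1 (scan_word phi).
  by rewrite /repeat_word /= cats0 mem_cat (perm_mem ord) mem_enum.
case: Delta D3 big bu hD => // D D3 big bu hD.
have degD v : (degree e v <= D.+1)%N by rewrite -hD; exact: degree_le_max.
have gap0 := total_gap_ge0 e_sym e_irr (ltW b0) l.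
apply: le_trans (total_gap_dobrushin e_sym e_irr (ltW b0) degD l scanV) _.
rewrite ler_wpM2r //; apply: le_trans (theta_dobrushin d01 D3 big).
by rewrite ler_wpM2r // theta_le // ltW.
Qed.

(** For a fixed degree the block radius, and then the number of scans, can be
    chosen once and for all. *)
Lemma mixes_fixed_degree (delta : R) (Delta : nat) : 0 < delta < 1 ->
  exists C, mixes_logarithmically delta Delta C.
Proof.
move=> d01; have [|D3] := ltnP Delta 3.
  by exists 0 => beta V e phi; rewrite leqNgt => /negP.
case: Delta D3 => // D D3; have D2 : (2 <= D)%N by [].
set beta1 := (1 - delta) * beta_u2 R D.+1.
have beta1_ge0 : 0 <= beta1.
  apply: mulr_ge0; last exact/ltW/beta_u2_gt0.
  by have /andP[_ /ltW] := d01; rewrite subr_ge0.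
pose rho1 := theta beta1 * D%:R; have rho1_lt1 : rho1 < 1 by exact: theta_subcritical.
have th0 := theta_ge0 beta1_ge0.
have rho1_ge0 : 0 <= rho1 by rewrite mulr_ge0.
have [r rP] : exists r : nat,
    theta beta1 * D.+1%:R / (1 - rho1) * rho1 ^+ r <= 4^-1.
  apply: small_multiple_power; first by rewrite rho1_ge0.
  by apply: divr_ge0; [exact: mulr_ge0 | rewrite subr_ge0; exact: ltW].
pose M := (D.+2 ^ r.+1)%N; pose q : R := (1 + expR (beta1 * D.+1%:R))^-1.
have q0 : 0 < q by rewrite invr_gt0 addr_gt0 ?expR_gt0.
have q1 : q <= 1 by rewrite invf_le1 ?addr_gt0 ?expR_gt0 // lerDl expR_ge0.
have [N NP] : exists N : nat, 2 * M%:R * (1 - q ^+ (M + M)) ^+ N <= 4^-1.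
  apply: small_multiple_power; last by rewrite mulr_ge0.
  apply/andP; split; first by rewrite subr_ge0 exprn_ile1 // ltW.
  by rewrite ltrBlDr ltrDl exprn_gt0.
have k01 : 0 < (2^-1 : R) < 1 by apply/andP; split; lra.
exists (N.+1%:R * (3 / (- ln 2^-1) + (ln 3)^-1)) => beta V e phi _.
move=> /andP[b0 /ltW bu] sg hD ord; have [e_sym e_irr] := sg.
apply: mixing_time_contraction => //; first exact: ltW.
  by apply: leq_trans (max_degree_le_card e); rewrite hD.
have degD v : (degree e v <= D.+1)%N by rewrite -hD; exact: degree_le_max.
have th_ge0 := theta_ge0 (ltW b0).
have th_le : theta beta <= theta beta1 by exact: theta_le.
have rho_le : theta beta * D%:R <= rho1 by rewrite ler_wpM2r.
have rho_lt1 := le_lt_trans rho_le rho1_lt1.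
have q_le v s : q <= plus_prob (e := e) beta v s by apply: plus_prob_lower => //; exact: ltW.
have q01 : 0 <= q <= 1 by rewrite ltW.
move=> l; have gap0 := total_gap_ge0 e_sym e_irr (ltW b0) l.
apply: le_trans (total_gap_block e_sym e_irr (ltW b0) degD rho_lt1
  r N.+1 q01 q_le ord l) _.
rewrite ler_wpM2r // -/M.
have tail : theta beta * D.+1%:R *
    ((theta beta * D%:R) ^+ r / (1 - theta beta * D%:R)) <= 4^-1.
  apply: le_trans rP; rewrite -[leRHS]mulrA [_^-1 * _]mulrC.
  have rho_pos : 0 <= theta beta * D%:R by rewrite mulr_ge0.
  have inv_ge0 : 0 <= (1 - theta beta * D%:R)^-1 by rewrite invr_ge0 subr_ge0 ltW.
  apply: ler_pM.
  - exact: mulr_ge0.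
  - by rewrite mulr_ge0 ?exprn_ge0.
  - by rewrite ler_wpM2r.
  - apply: ler_pM => //; first exact: exprn_ge0.
      by rewrite lerXn2r ?nnegrE.
    by rewrite lef_pV2 ?posrE ?subr_gt0 // lerD2l lerN2.
have err : 2 * (1 - q ^+ (M + M)) ^+ N.+1 * M%:R <= 4^-1.
  apply: le_trans NP; rewrite mulrAC ler_wpM2l ?mulr_ge0 //.
  rewrite exprS ler_piMl ?exprn_ge0 ?subr_ge0 ?exprn_ile1 ?(ltW q0) //.
  by rewrite lerBlDr lerDl exprn_ge0 // ltW.
by lra.
Qed.

End Mixing.

Unset Implicit Arguments.

Theorem corollary1p7 (R : realType) (delta : R) (hdelta : 0 < delta < 1) :
  exists C : R,
    forall (Delta : nat) (beta : R) (V : finType) (e : rel V) (phi : seq V),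
      (3 <= Delta)%N ->
      0 < beta < (1 - delta) * beta_u2 R Delta ->
      simple_graph e ->
      max_degree e = Delta ->
      vertex_ordering phi ->
      exists T : nat,
        is_mixing_time (symmetrized_scan (ising e beta) phi) (ising e beta) T
        /\ T%:R <= C * ln (#|V|%:R : R).
Proof.
have [C1 large] := mixes_large_degree hdelta.
have [C0 fixed] := choice (fun Delta => mixes_fixed_degree Delta hdelta).
have [n nP] : exists n : nat, 4 / delta <= n%:R.
  by exists (Num.truncn (4 / delta)).+1; rewrite ltW // truncnS_gt.
pose C := Num.max C1 (\big[Num.max/C1]_(Delta < n) C0 Delta).
exists C => Delta; suff : mixes_logarithmically delta Delta C by [].
have [nD|Dn] := leqP n Delta.
  apply: ler_mixes_logarithmically (large Delta _); first by rewrite le_max lexx.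
  by apply: le_trans nP _; rewrite ler_nat.
apply: ler_mixes_logarithmically (fixed Delta); rewrite le_max; apply/orP; right.
exact: (le_bigmax _ (fun i : 'I_n => C0 i) (Ordinal Dn)).
Qed.
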